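(* Let $\lambda\in\mathbb C\setminus(\mathbb Z\setminus\{0\})$ and let $V=M^{\lambda-1}$ be the Verma module over $\mathfrak{sl}(2)$ with highest weight $\lambda-1$, regarded as a $\mathfrak{gl}(\lambda)$-module. Let $n\ge1$ and let $\mathfrak{gl}(\lambda)$ act on $V^{\otimes n}$ by $a\mapsto\sum_{j=1}^n 1\otimes\cdots\otimes a\otimes\cdots\otimes1$ ($a$ in the $j$-th place) and $\mathfrak S_n$ act by permuting the factors. Then $$V^{\otimes n}=\bigoplus_{\nu}V^{\nu}\otimes S^{\nu}$$ as a $\mathfrak{gl}(\lambda)\times\mathfrak S_n$-module, where $\nu$ runs over the partitions of $n$, $S^\nu$ is the irreducible $\mathfrak S_n$-module corresponding to $\nu$, and each $V^\nu$ is an irreducible $\mathfrak{gl}(\lambda)$-module.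
   Context: $\mathfrak{sl}(2)$ has basis $X,H,Y$ with $[X,Y]=H$, $[H,X]=2X$, $[H,Y]=-2Y$. For $\lambda\in\mathbb C\setminus(\mathbb Z\setminus\{0\})$, $\mathfrak A_\lambda=U(\mathfrak{sl}(2))/I_\lambda$ where $I_\lambda$ is the two-sided ideal generated by $\Omega-\frac12(\lambda^2-1)$, $\Omega=2YX+\frac12H^2+H$; $\mathfrak{gl}(\lambda)$ is $\mathfrak A_\lambda$ with bracket $[a,b]=ab-ba$. The Verma module $M^{\lambda-1}$ is generated by $v$ with $Xv=0$, $Hv=(\lambda-1)v$, with basis $Y^jv$, $j\ge0$; $\Omega$ acts on it by $\frac12(\lambda^2-1)$, so it is an $\mathfrak A_\lambda$-module and hence a $\mathfrak{gl}(\lambda)$-module. *)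

(* Defs.v *)
From mathcomp Require Import all_boot all_order all_algebra all_fingroup.
From mathcomp Require Import reals.
From mathcomp Require Export complex.
From mathcomp Require Export mpoly.

Set Implicit Arguments.
Unset Strict Implicit.
Unset Printing Implicit Defensive.

Import GRing.Theory Num.Theory.
Local Open Scope ring_scope.

(* The generators X, H, Y of sl(2); a word [:: g1; ...; gk] stands for the   *)
(* monomial g1 g2 ... gk in U(sl(2)), hence (through U(sl2) -> A_lambda) for *)
(* an element of gl(lambda).  Words span the image of A_lambda in End(V),    *)
(* and (by linearity) every element of gl(lambda) acts on V^{(x)n} as a      *)
(* linear combination of word actions.                                       *)
Inductive sl2gen := gX | gH | gY.

Section Verma.
Variable R : realType.
Local Notation C := (R[i]).
Variable lam : C.

(* Verma module M^{lam-1}: basis Y^k v (k >= 0), with                         *)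
(*   Y.Y^k v = Y^{k+1} v,  H.Y^k v = (lam-1-2k) Y^k v,                        *)
(*   X.Y^k v = k(lam-k) Y^{k-1} v   (X v = 0).                                *)
(* verma_basis_act g k = (c, k') means  g . Y^k v = c Y^{k'} v.               *)
Definition verma_basis_act (g : sl2gen) (k : nat) : C * nat :=
  match g with
  | gY => (1, k.+1)
  | gH => (lam - 1 - (2 * k)%:R, k)
  | gX => match k with
          | 0 => (0, 0)
          | k'.+1 => (k%:R * (lam - k%:R), k')
          end
  end.

Variable n : nat.

(* V^{(x)n}: the basis tensor Y^{m_1}v (x) ... (x) Y^{m_n}v is encoded by the *)
(* monomial 'X_[m]; so V^{(x)n} = {mpoly C[n]} as a vector space.             *)
Definition tens := {mpoly C[n]}.

Definition mlin (f : 'X_{1..n} -> tens) (p : tens) : tens :=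
  \sum_(m <- msupp p) p@_m *: f m.

Definition factor_gen (j : 'I_n) (g : sl2gen) (m : 'X_{1..n}) : tens :=
  let: (c, k) := verma_basis_act g (m j) in
  c *: 'X_[[multinom (if i == j then k else m i) | i < n]].

Definition factor_word (j : 'I_n) (w : seq sl2gen) (p : tens) : tens :=
  foldr (fun g q => mlin (factor_gen j g) q) p w.

Definition gl_act (w : seq sl2gen) (p : tens) : tens :=
  \sum_(j < n) factor_word j w p.

(* S_n acts by permuting the factors: the factor in position i goes to      *)
(* position s i.                                                             *)
Definition perm_act (s : 'S_n) (p : tens) : tens :=
  mlin (fun m => 'X_[[multinom m (s^-1 i)%g | i < n]]) p.

Definition is_subspace (U : tens -> Prop) : Prop :=
  U 0 /\ forall (a : C) p q, U p -> U q -> U (a *: p + q).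

Definition gl_invariant (U : tens -> Prop) : Prop :=
  forall w p, U p -> U (gl_act w p).

Definition gl_irreducible (U : tens -> Prop) : Prop :=
  [/\ is_subspace U, gl_invariant U, (exists2 p, U p & p != 0) &
      forall W : tens -> Prop, is_subspace W -> gl_invariant W ->
        (forall p, W p -> U p) -> (exists2 p, W p & p != 0) ->
        forall p, U p -> W p].

End Verma.

Section Specht.
Variable n : nat.

(* a partition of n, as the (padded with zeros) nonincreasing sequence of    *)
(* its n possible row lengths, summing to n                                   *)
Definition is_partition (nu : {ffun 'I_n -> 'I_n.+1}) : bool :=
  [forall i : 'I_n, forall j : 'I_n, (i <= j)%N ==> (nu j <= nu i)%N] &&
  (\sum_(i < n) (nu i : nat) == n)%N.

Definition partitions := {nu : {ffun 'I_n -> 'I_n.+1} | is_partition nu}.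

(* The n cells of the Young diagram of nu are numbered 0..n-1 row by row.    *)
Definition row_of (nu : partitions) (k : nat) : nat :=
  #|[pred r : 'I_n | (\sum_(i < n | (i <= r)%N) (val nu i : nat) <= k)%N]|.
Definition col_of (nu : partitions) (k : nat) : nat :=
  (k - \sum_(i < n | (i < row_of nu k)%N) (val nu i : nat))%N.

(* A tableau of shape nu is t : 'S_n, entry e sitting in cell number t e;  *)
(* the tableau s t (entries renamed by s) is (s^-1 * t)%g in mathcomp order. *)
(* Tabloids: maps entry |-> row.                                             *)
Definition tabloid := {ffun 'I_n -> 'I_n.+1}.

Definition tabloid_of (nu : partitions) (t : 'S_n) : tabloid :=
  [ffun e => inord (row_of nu (t e))].

Definition col_stab (nu : partitions) (t : 'S_n) (s : 'S_n) : bool :=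
  [forall e : 'I_n, col_of nu (t (s e)) == col_of nu (t e)].

Variable R : realType.
Local Notation C := (R[i]).

Definition Mperm := {ffun tabloid -> C}.

Definition delta (tau : tabloid) : Mperm := [ffun tau' => (tau' == tau)%:R].

(* S_n acts on M^nu by  pi.{t} = {pi t}  (entries are permuted) *)
Definition perm_tab (pi : 'S_n) (f : Mperm) : Mperm :=
  [ffun tau : tabloid => f [ffun e => tau (pi e)]].

Definition polytab (nu : partitions) (t : 'S_n) : Mperm :=
  \sum_(s : 'S_n | col_stab nu t s)
     (-1) ^+ odd_perm s *: delta (tabloid_of nu (s^-1 * t)%g).

Definition in_specht (nu : partitions) (f : Mperm) : Prop :=
  exists c : 'S_n -> C, f = \sum_(t : 'S_n) c t *: polytab nu t.

Definition specht_basis (nu : partitions) (d : nat) (b : 'I_d -> Mperm) : Prop :=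
  [/\ forall i, in_specht nu (b i),
      forall f, in_specht nu f -> exists c : 'I_d -> C, f = \sum_(i < d) c i *: b i &
      forall c : 'I_d -> C, \sum_(i < d) c i *: b i = 0 -> forall i, c i = 0].

End Specht.

(* The decomposition  V^{(x)n} = (+)_nu V^nu (x) S^nu  of gl(lambda) x S_n-  *)
(* modules, with V^nu irreducible.  V^nu is realised as an irreducible       *)
(* gl(lambda)-submodule U nu of V^{(x)n}; d nu = dim S^nu with basis b nu;   *)
(* the isomorphism  (+)_nu U nu (x) S^nu -> V^{(x)n}  sends u (x) b nu i to  *)
(* psi nu i u.                                                                *)
Definition gl_Sn_decomposition (R : realType) (lam : R[i]) (n : nat)
  (U : partitions n -> tens R n -> Prop) (d : partitions n -> nat)
  (b : forall nu, 'I_(d nu) -> Mperm n R)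
  (psi : forall nu, 'I_(d nu) -> tens R n -> tens R n) : Prop :=
  (
      (forall nu, gl_irreducible lam (U nu)) /\
      (forall nu, specht_basis nu (b nu)) /\
      (forall nu i (a : R[i]) p q, U nu p -> U nu q ->
        psi nu i (a *: p + q) = a *: psi nu i p + psi nu i q) /\
      (forall nu i w p, U nu p -> psi nu i (gl_act lam w p) = gl_act lam w (psi nu i p)) /\
      (forall nu i (pi : 'S_n) (c : 'I_(d nu) -> R[i]),
        perm_tab pi (b nu i) = \sum_(k < d nu) c k *: b nu k ->
        forall p, U nu p -> perm_act pi (psi nu i p) = \sum_(k < d nu) c k *: psi nu k p) /\
      ((forall x : tens R n, exists u : forall nu, 'I_(d nu) -> tens R n,
        (forall nu i, U nu (u nu i)) /\ x = \sum_(nu : partitions n) \sum_(i < d nu) psi nu i (u nu i))) /\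
      (forall u : forall nu, 'I_(d nu) -> tens R n, (forall nu i, U nu (u nu i)) ->
        \sum_(nu : partitions n) \sum_(i < d nu) psi nu i (u nu i) = 0 ->
        forall nu i, u nu i = 0)).

(* Main.v *)
(* Let [young nu = b a b], where [a] and [b] are the row symmetrizer and the
   column antisymmetrizer of the diagram of [nu].  It is self-adjoint for the
   positive involution [g |-> g^-1] of C[S_n], primitive ([e x e] is a multiple
   of [e]), and the [young nu] are pairwise orthogonal.  Their averages over
   conjugation are therefore independent class functions; as there are at most
   as many conjugacy classes as partitions, they span the class functions, so 1
   is a combination of them.  Hence the tensor power is the sum of the
   [S^nu (x) V^nu] with [V^nu = young nu (V^{(x)n})].

   For irreducibility, polynomials in H followed by a power of X or Y act on any
   given vector as arbitrary matrix units, because [k (lam - k) != 0] for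
   [k > 0].  Sending the exponents [m_j] of a vector [u] first to large distinct
   values and then to arbitrary ones shows that a submodule containing [u]
   contains [K y] for all [y], where [K = sum_g u@_(m o g) g].  If [u] is in
   [V^nu] then some [K] acts on [V^nu], compressed by [young nu], as a nonzero
   scalar. *)
From HB Require Import structures.
Require Import Defs.
From mathcomp Require Import all_boot all_order all_algebra all_fingroup.
From mathcomp Require Import reals complex ssrcomplements mpoly.
Import GRing.Theory Num.Theory.
Set Implicit Arguments.
Unset Strict Implicit.
Unset Printing Implicit Defensive.

(** * Group algebras *)

(** A copy of the function type under its own name, so that it can carry the convolution product. *)
Definition galg (F : numClosedFieldType) (gT : finGroupType) := {ffun gT -> F}.

HB.instance Definition _ (F : numClosedFieldType) (gT : finGroupType) :=
  GRing.Lmodule.copy (galg F gT) {ffun gT -> F^o}.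

Section GroupAlgebra.
Local Open Scope ring_scope.
Variables (F : numClosedFieldType) (gT : finGroupType).
Local Notation A := (galg F gT).
Implicit Types (x y z : A) (g h : gT) (c : F).

Definition gel g : A := [ffun h => (h == g)%:R].
Definition gmul x y : A := [ffun g => \sum_h x h * y (h^-1 * g)%g].
Definition gstar x : A := [ffun g => (x g^-1%g)^*].

Lemma galgP x y : x =1 y <-> x = y.
Proof. by split=> [/ffunP|->]. Qed.

Lemma galgDE x y g : (x + y) g = x g + y g. Proof. by rewrite ffunE. Qed.
Lemma galgZE c x g : (c *: x) g = c * x g. Proof. by rewrite ffunE. Qed.
Lemma galg0E g : (0 : A) g = 0. Proof. by rewrite ffunE. Qed.
Lemma galg_sumE (I : Type) (r : seq I) (P : pred I) (f : I -> A) g :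
  (\sum_(i <- r | P i) f i) g = \sum_(i <- r | P i) f i g.
Proof. by elim/big_rec2: _ => [|i y1 y2 _ <-]; rewrite ?galg0E ?galgDE. Qed.

Let gmulA : associative gmul.
Proof.
move=> x y z; apply/galgP => g; rewrite !ffunE.
under eq_bigr => h _ do rewrite ffunE mulr_sumr.
under [RHS]eq_bigr => k _ do rewrite ffunE mulr_suml.
rewrite [RHS]exchange_big; apply: eq_bigr => h _ /=.
rewrite [RHS](reindex_inj (mulgI h)); apply: eq_bigr => k _ /=.
by rewrite mulrA mulKg invMg mulgA.
Qed.

Let gmul1g : left_id (gel 1) gmul.
Proof.
move=> x; apply/galgP => g; rewrite ffunE (bigD1 1%g) //= big1 => [|h h1].
  by rewrite ffunE eqxx mul1r addr0 invg1 mul1g.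
by rewrite ffunE (negPf h1) mul0r.
Qed.

Let gmulg1 : right_id (gel 1) gmul.
Proof.
move=> x; apply/galgP => g; rewrite ffunE (bigD1 g) //= big1 => [|h h1].
  by rewrite ffunE mulVg eqxx mulr1 addr0.
by rewrite ffunE -eq_invg_mul invgK (negPf h1) mulr0.
Qed.

Let gmulDl : left_distributive gmul +%R.
Proof.
move=> x y z; apply/galgP => g; rewrite galgDE !ffunE -big_split /=.
by apply: eq_bigr => h _; rewrite galgDE mulrDl.
Qed.

Let gmulDr : right_distributive gmul +%R.
Proof.
move=> x y z; apply/galgP => g; rewrite galgDE !ffunE -big_split /=.
by apply: eq_bigr => h _; rewrite galgDE mulrDr.
Qed.

Let gel1_neq0 : gel 1 != 0.
Proof.
apply/eqP => /galgP /(_ 1%g); rewrite ffunE eqxx galg0E.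
by apply/eqP/oner_neq0.
Qed.

HB.instance Definition _ := GRing.Zmodule_isNzRing.Build A
  gmulA gmul1g gmulg1 gmulDl gmulDr gel1_neq0.

Let gscaleAl c x y : c *: (x * y) = (c *: x) * y.
Proof.
apply/galgP => g; rewrite galgZE !ffunE mulr_sumr; apply: eq_bigr => h _.
by rewrite galgZE mulrA.
Qed.

HB.instance Definition _ := GRing.Lmodule_isLalgebra.Build F A gscaleAl.

Let gscaleAr c x y : c *: (x * y) = x * (c *: y).
Proof.
apply/galgP => g; rewrite galgZE !ffunE mulr_sumr; apply: eq_bigr => h _.
by rewrite galgZE mulrCA.
Qed.

HB.instance Definition _ := GRing.Lalgebra_isAlgebra.Build F A gscaleAr.

Lemma galgME x y g : (x * y) g = \sum_h x h * y (h^-1 * g)%g.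
Proof. by rewrite [LHS]ffunE. Qed.

Lemma gel1 : gel 1 = 1. Proof. by []. Qed.

Lemma gelE g h : gel g h = (h == g)%:R. Proof. by rewrite ffunE. Qed.

Lemma gel_mulE g x h : (gel g * x) h = x (g^-1 * h)%g.
Proof.
rewrite galgME (bigD1 g) //= big1 => [|k kg].
  by rewrite gelE eqxx mul1r addr0.
by rewrite gelE (negPf kg) mul0r.
Qed.

Lemma mul_gelE g x h : (x * gel g) h = x (h * g^-1)%g.
Proof.
rewrite galgME (bigD1 (h * g^-1)%g) //= big1 => [|k kg].
  by rewrite gelE invMg invgK mulgKV eqxx mulr1 addr0.
rewrite gelE; case: eqP => [E|]; rewrite ?mulr0 //.
by case/eqP: kg; rewrite -E invMg invgK mulKVg.
Qed.

Lemma gelM g h : gel g * gel h = gel (g * h)%g.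
Proof. by apply/galgP => k; rewrite gel_mulE !gelE (canF_eq (mulKVg g)). Qed.

Lemma galgE x : x = \sum_g x g *: gel g.
Proof.
apply/galgP => h; rewrite galg_sumE (bigD1 h) //= big1 => [|g gh].
  by rewrite galgZE gelE eqxx mulr1 addr0.
by rewrite galgZE gelE eq_sym (negPf gh) mulr0.
Qed.

Lemma gstarE x g : gstar x g = (x g^-1%g)^*. Proof. by rewrite ffunE. Qed.

Lemma gstarK : involutive gstar.
Proof. by move=> x; apply/galgP => g; rewrite !gstarE invgK conjCK. Qed.

Lemma gstarD : {morph gstar : x y / x + y}.
Proof. by move=> x y; apply/galgP => g; rewrite !(gstarE, galgDE) rmorphD. Qed.

Lemma gstarZ c x : gstar (c *: x) = c^* *: gstar x.
Proof. by apply/galgP => g; rewrite !(gstarE, galgZE) rmorphM. Qed.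

Lemma gstar0 : gstar 0 = 0.
Proof. by apply/galgP => g; rewrite !(gstarE, galg0E) rmorph0. Qed.

Lemma gstar_sum (I : Type) (r : seq I) (P : pred I) (f : I -> A) :
  gstar (\sum_(i <- r | P i) f i) = \sum_(i <- r | P i) gstar (f i).
Proof. exact: (big_morph _ gstarD gstar0). Qed.

Lemma gstar_gel g : gstar (gel g) = gel g^-1.
Proof.
apply/galgP => h; rewrite gstarE !gelE conjC_nat.
by rewrite -(inj_eq invg_inj) invgK.
Qed.

Lemma gstarM x y : gstar (x * y) = gstar y * gstar x.
Proof.
apply/galgP => g; rewrite gstarE !galgME rmorph_sum.
rewrite [RHS](reindex_inj (mulgI g)) /=.
apply: eq_bigr => h _; rewrite rmorphM !gstarE /= mulrC.
by rewrite !invMg !invgK mulKg.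
Qed.

Lemma gstar_mul1E x : (gstar x * x) 1%g = \sum_g `|x g| ^+ 2.
Proof.
rewrite galgME (reindex_inj invg_inj); apply: eq_bigr => g _ /=.
by rewrite gstarE !invgK mulg1 mulrC -normCK.
Qed.

Lemma gstar_mul1_eq0 x : (gstar x * x) 1%g = 0 -> x = 0.
Proof.
rewrite gstar_mul1E => /eqP; rewrite psumr_eq0 => [|g _]; last exact: exprn_ge0.
move=> /allP x0; apply/galgP => g; rewrite galg0E; apply/eqP.
by have := x0 g (mem_index_enum g); rewrite expf_eq0 /= normr_eq0.
Qed.

(** Positivity of the involution: the nonvanishing claims about [e] and [young] below come down to
    it. *)
Lemma gstar_mul_eq0 x : gstar x * x = 0 -> x = 0.
Proof. by move=> x0; apply: gstar_mul1_eq0; rewrite x0 galg0E. Qed.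

Definition gavg x : A := \sum_g gel g * x * gel g^-1.

Lemma gavg_comm x y : gavg x * y = y * gavg x.
Proof.
rewrite (galgE y) [LHS]mulr_sumr [RHS]mulr_suml; apply: eq_bigr => h _.
rewrite -scalerAl -scalerAr; congr (_ *: _).
rewrite [LHS]mulr_suml [RHS]mulr_sumr [LHS](reindex_inj (mulgI h)); apply: eq_bigr => g _.
by rewrite /= -gelM !mulrA -[RHS]mulrA -[LHS]mulrA !gelM invMg mulgKV.
Qed.

Lemma gavg_class x g h : gavg x (g ^ h)%g = gavg x g.
Proof.
have /galgP/(_ (g * h)%g) := gavg_comm x (gel h).
by rewrite mul_gelE gel_mulE mulgK => ->; rewrite conjgE.
Qed.

Lemma gavg_star x : gstar x = x -> gstar (gavg x) = gavg x.
Proof.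
move=> xs; rewrite gstar_sum; apply: eq_bigr => g _.
by rewrite !gstarM !gstar_gel xs invgK mulrA.
Qed.

Lemma gavg1E x : gavg x 1%g = #|gT|%:R * x 1%g.
Proof.
rewrite galg_sumE (eq_bigr (fun=> x 1%g)) => [|g _].
  by rewrite sumr_const mulr_natl.
by rewrite mul_gelE gel_mulE invgK mul1g mulVg.
Qed.

End GroupAlgebra.

Arguments gel {F gT}.

(** * Self-adjoint primitive elements *)

Section Primitive.
Local Open Scope ring_scope.
Variables (F : numClosedFieldType) (gT : finGroupType).
Local Notation A := (galg F gT).
Variable e : A.
Hypotheses (e_star : gstar e = e) (e_neq0 : e != 0).
Hypothesis e_prim : forall x, exists c, e * x * e = c *: e.

(** The scalar of [e * x * e] relative to [e], read off at the identity; the denominator is nonzero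
    by [corner_unit_neq0]. *)
Definition corner (x : A) : F := (e * x * e) 1%g / e 1%g.

Let e_sq : e * e != 0.
Proof.
by apply: contra e_neq0 => /eqP e0; apply/eqP/gstar_mul_eq0; rewrite e_star.
Qed.

(** Otherwise [gstar e * e = e * e], being a multiple of [e], has coefficient 0 at the identity, and
    positivity gives [e = 0]. *)
Lemma corner_unit_neq0 : e 1%g != 0.
Proof.
apply/eqP => e1; have [c] := e_prim 1; rewrite mulr1 => ec.
case/eqP: e_neq0; apply: gstar_mul1_eq0.
by rewrite e_star ec galgZE e1 mulr0.
Qed.

Lemma cornerE x : e * x * e = corner x *: e.
Proof.
by have [c ec] := e_prim x; rewrite /corner ec galgZE mulfK ?corner_unit_neq0.
Qed.

Lemma corner_is_additive : additive corner.
Proof. by move=> x y; rewrite /corner mulrBr mulrBl !ffunE mulrBl. Qed.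
HB.instance Definition _ := GRing.isZmodMorphism.Build A F corner corner_is_additive.

Lemma corner_is_scalable : scalable_for *%R corner.
Proof. by move=> c x; rewrite /corner -scalerAr -scalerAl galgZE mulrA. Qed.
HB.instance Definition _ := GRing.isScalable.Build F A F *%R corner corner_is_scalable.

Lemma corner1_neq0 : corner 1 != 0.
Proof.
apply: contra e_sq => /eqP h0.
by have := cornerE 1; rewrite mulr1 h0 scale0r => ->.
Qed.

Lemma corner_star x : corner (gstar x) = (corner x)^*.
Proof.
have: gstar (e * x * e) = (corner x)^* *: e by rewrite cornerE gstarZ e_star.
rewrite !gstarM e_star mulrA cornerE => /galgP/(_ 1%g).
by rewrite !galgZE => /(mulIf corner_unit_neq0) ->.
Qed.

(** By [corner_star] the summands are squared moduli, and the one at the identity is nonzero. *)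
Lemma corner_gel_neq0 : \sum_g corner (gel g) * corner (gel g^-1) != 0.
Proof.
rewrite (eq_bigr (fun g => `|corner (gel g)| ^+ 2)) => [|g _]; last first.
  by rewrite -gstar_gel corner_star normCK.
rewrite psumr_eq0 => [|g _]; last exact: exprn_ge0.
apply/negP => /allP/(_ 1%g (mem_index_enum _)).
by rewrite expf_eq0 /= normr_eq0 gel1 (negPf corner1_neq0).
Qed.

(** Expanding [gstar x] over the group writes [gstar (x * e) * (x * e)] as a combination of the
    elements [e * (gel g * x) * e], all of which vanish. *)
Lemma corner_separating x : (forall g, corner (gel g * x) = 0) -> x * e = 0.
Proof.
move=> cx; apply: gstar_mul_eq0; rewrite gstarM e_star (galgE (gstar x)).
rewrite mulr_sumr mulr_suml big1 // => g _.
by rewrite -scalerAr -scalerAl -mulrA (mulrA _ x) mulrA cornerE cx !(scale0r, scaler0).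
Qed.

End Primitive.

(** * Young diagrams *)

Section Diagram.
Variables (I : finType) (row col : I -> nat).
Hypothesis cell_up : forall x k, k < row x -> exists2 y, row y = k & col y = col x.

Variable rho : I -> nat.
Hypothesis rho_inj : forall x y, col x = col y -> rho x = rho y -> x = y.

Let ncol (f : I -> nat) c k := #|[pred x | (col x == c) && (f x < k)]|.

Let ncol_le_bound (f : I -> nat) c k :
  (forall x y, col x = col y -> f x = f y -> x = y) -> ncol f c k <= k.
Proof.
move=> f_inj; case: k => [|k].
  by rewrite /ncol eq_card0 // => x; rewrite inE andbF.
pose g x : 'I_k.+1 := inord (f x).
rewrite -[leqRHS]card_ord /ncol -(@card_in_imset _ _ g) ?max_card //.
move=> x y /[!inE] /andP[/eqP cx fx] /andP[/eqP cy fy] /(congr1 val).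
by rewrite /= !inordK // => fxy; apply: f_inj => //; rewrite cx cy.
Qed.

(** If column [c] reaches row [k], its rows below [k] are all filled, while at most [k] distinct
    labels are less than [k]. Otherwise the right side counts the whole column. *)
Let ncol_le c k : ncol rho c k <= ncol row c k.
Proof.
case: (boolP [exists x, (col x == c) && (k <= row x)]) => [/existsP|].
  case=> x /andP[/eqP <- kx]; apply: leq_trans (ncol_le_bound _ _ _) _ => //.
  case: (posnP k) => [->//|k0]; rewrite -[leqLHS]card_ord.
  have up (i : 'I_k) : exists y, (row y == i) && (col y == col x).
    have [y ry cy] := cell_up (leq_trans (ltn_ord i) kx).
    by exists y; rewrite ry cy !eqxx.
  pose g i := xchoose (up i).
  have gP i : row (g i) = i /\ col (g i) = col x.
    by have /andP[/eqP ? /eqP ?] := xchooseP (up i).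
  have g_inj : injective g.
    move=> i j gij; apply/val_inj => /=.
    by have [<- _] := gP i; have [<- _] := gP j; rewrite gij.
  rewrite -(card_imset _ g_inj); apply/subset_leq_card/subsetP => y.
  by case/imsetP => i _ ->; have [ri ci] := gP i; rewrite !inE ri ci eqxx ltn_ord.
rewrite negb_exists => /forallP lek.
apply/subset_leq_card/subsetP => x; rewrite !inE => /andP[cx _].
by rewrite cx; have := lek x; rewrite cx /= -ltnNge.
Qed.

Let M := \max_x col x.

Let card_ncol f k :
  #|[pred x | f x < k]| = \sum_(c < M.+1) ncol f c k.
Proof.
rewrite -sum1_card (partition_big (fun x => inord (col x) : 'I_M.+1) predT) //=.
apply: eq_bigr => c _; rewrite /ncol -sum1_card; apply: eq_bigl => x; rewrite !inE andbC.
congr (_ && _); rewrite -val_eqE /= inordK // ltnS.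
exact: leq_bigmax.
Qed.

Lemma diagram_dominance k : #|[pred x | rho x < k]| <= #|[pred x | row x < k]|.
Proof. by rewrite !card_ncol; apply: leq_sum => c _. Qed.

(** Equal totals force equality in each column, by [ncol_le]. So [rho] takes on a column the same
    values as [row], and [q] moves [x] within its column to row [rho x]. *)
Lemma diagram_rearrange :
  (forall k, #|[pred x | rho x < k]| = #|[pred x | row x < k]|) ->
  exists q : {perm I}, forall x, col (q x) = col x /\ row (q x) = rho x.
Proof.
move=> eqk.
have eqck c k : c < M.+1 -> ncol rho c k = ncol row c k.
  move=> cM; have := eqk k; rewrite !card_ncol => /eqP.
  have := leqif_sum (fun (c : 'I_M.+1) (_ : true) => leqif_eq (ncol_le c k)).
  by move=> [_ ->] /forallP /(_ (Ordinal cM)) /eqP.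
have ex x : exists y, (col y == col x) && (row y == rho x).
  (* If the column had no cell in row [rho x], its count for [row] would not grow from [rho x] to
     [rho x + 1], whereas the count for [rho] grows because of [x]. *)
  apply/existsP; apply: contraT; rewrite negb_exists => /forallP none.
  have cM : col x < M.+1 by rewrite ltnS; exact: leq_bigmax.
  have: ncol rho (col x) (rho x) < ncol rho (col x) (rho x).+1.
    apply: proper_card; apply/properP; split.
      by apply/subsetP => y /[!inE] /andP[-> /ltnW].
    by exists x; rewrite !inE eqxx ?ltnSn ?ltnn.
  rewrite !eqck // ltnNge; case/negP; apply/subset_leq_card/subsetP => y /[!inE].
  case/andP => cy; rewrite ltnS leq_eqVlt => /orP[ry|->]; last by rewrite cy.
  by have := none y; rewrite cy ry.
pose q x := xchoose (ex x).
have qP x : col (q x) = col x /\ row (q x) = rho x.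
  by have /andP[/eqP ? /eqP ?] := xchooseP (ex x).
have q_inj : injective q.
  move=> x y qxy; have [cx rx] := qP x; have [cy ry] := qP y.
  by apply: rho_inj; rewrite -?cx -?cy -?rx -?ry qxy.
by exists (perm q_inj) => x; rewrite permE.
Qed.

End Diagram.

(** * The row-by-row numbering of the cells *)

Section YoungDiagram.
Variables (n : nat) (nu : partitions n).

(** The number of the first cell of row [r], which ends just before cell [part_sum r.+1]. *)
Definition part_sum r := \sum_(i < n | i < r) val nu i.

Lemma part_sumS (r : 'I_n) : part_sum r.+1 = part_sum r + val nu r.
Proof.
rewrite /part_sum (bigD1 r) //= addnC; congr addn; apply: eq_bigl => i.
by rewrite ltnS ltn_neqAle andbC.
Qed.

Lemma leq_part_sum r s : r <= s -> part_sum r <= part_sum s.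
Proof.
move=> rs; rewrite /part_sum [leqRHS](bigID (fun i : 'I_n => i < r)) /=.
rewrite -[leqLHS]addn0 leq_add // eq_leq //; apply: eq_bigl => i.
by case: (ltnP i r) => [ir|]; rewrite ?andbT ?andbF // (leq_trans ir).
Qed.

Lemma part_sum_total : part_sum n = n.
Proof.
have /andP[_ /eqP E] := valP nu; rewrite -[RHS]E.
by apply: eq_bigl => i; rewrite ltn_ord.
Qed.

Lemma part_nonincr (i j : 'I_n) : i <= j -> val nu j <= val nu i.
Proof. by have /andP[/forallP/(_ i)/forallP/(_ j)/implyP] := valP nu. Qed.

Lemma card_ord_lt r : r <= n -> #|[pred x : 'I_n | x < r]| = r.
Proof.
by move=> rn; rewrite -sum1_card -(big_ord_widen n (fun=> 1)) // sum1_card card_ord.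
Qed.

Lemma row_of_eq k r : r < n -> part_sum r <= k < part_sum r.+1 -> row_of nu k = r.
Proof.
move=> rn /andP[rk kr]; rewrite -(card_ord_lt (ltnW rn)); apply: eq_card => s.
change ((part_sum s.+1 <= k) = (s < r)).
case: (ltnP s r) => [sr|rs]; first by rewrite (leq_trans (leq_part_sum sr)).
by apply/negbTE; rewrite -ltnNge (leq_trans kr) // leq_part_sum.
Qed.

Lemma row_of_bounds k : k < n ->
  row_of nu k < n /\ part_sum (row_of nu k) <= k < part_sum (row_of nu k).+1.
Proof.
move=> kn; have ex : exists r, k < part_sum r.+1.
  by exists n; rewrite (leq_trans kn) // -{1}part_sum_total leq_part_sum.
case: (ex_minnP ex) => r kr rmin.
have rn : r < n.
  rewrite -(ltn_predK kn) ltnS rmin //.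
  by rewrite (ltn_predK kn) part_sum_total.
have rk : part_sum r <= k < part_sum r.+1.
  rewrite kr andbT leqNgt; case: r rmin {kr rn} => [|r] rmin.
    by rewrite /part_sum big1.
  by apply/negP => /rmin; rewrite ltnn.
by rewrite (row_of_eq rn rk).
Qed.

Lemma row_col_ofK k : k < n -> part_sum (row_of nu k) + col_of nu k = k.
Proof. by move=> /row_of_bounds[_ /andP[rk _]]; rewrite /col_of subnKC. Qed.

Lemma cell_of_inj (x y : 'I_n) :
  row_of nu x = row_of nu y -> col_of nu x = col_of nu y -> x = y.
Proof.
move=> rxy cxy; apply/val_inj.
by rewrite /= -(row_col_ofK (ltn_ord x)) rxy cxy row_col_ofK.
Qed.

(** Row lengths do not increase downwards, so the column index of [x] fits into every earlier row.
    This is the hypothesis [cell_up] on abstract diagrams. *)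
Lemma cell_of_up (x : 'I_n) k : k < row_of nu x ->
  exists2 y : 'I_n, row_of nu y = k & col_of nu y = col_of nu x.
Proof.
move=> kx; have [rn /andP[_ xr]] := row_of_bounds (ltn_ord x).
have kn := ltn_trans kx rn.
have ck : part_sum k + col_of nu x < part_sum k.+1.
  rewrite (part_sumS (Ordinal kn)) ltn_add2l.
  apply: leq_trans (part_nonincr (_ : Ordinal kn <= Ordinal rn)); last exact: ltnW.
  by rewrite -(ltn_add2l (part_sum (row_of nu x))) row_col_ofK // -(part_sumS (Ordinal rn)).
have yn : part_sum k + col_of nu x < n.
  by rewrite (leq_trans ck) // -[leqRHS]part_sum_total leq_part_sum.
have ry : row_of nu (Ordinal yn) = k.
  by apply: row_of_eq => //=; rewrite leq_addr.
by exists (Ordinal yn) => //; rewrite /col_of -/(part_sum _) ry addKn.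
Qed.

Lemma card_row_of_lt k : k <= n -> #|[pred x : 'I_n | row_of nu x < k]| = part_sum k.
Proof.
move=> kn; rewrite -[RHS]card_ord_lt; last first.
  by rewrite -[leqRHS]part_sum_total leq_part_sum.
apply: eq_card => x; rewrite !inE; have [_ /andP[rx xr]] := row_of_bounds (ltn_ord x).
case: ltnP => h; first by rewrite (leq_trans xr) // leq_part_sum.
by apply/esym/negbTE; rewrite -leqNgt (leq_trans _ rx) // leq_part_sum.
Qed.

End YoungDiagram.

Lemma partition_eq n (nu mu : partitions n) :
  (forall k, k <= n ->
     #|[pred x : 'I_n | row_of nu x < k]| = #|[pred x : 'I_n | row_of mu x < k]|) ->
  nu = mu.
Proof.
move=> E; have S k : k <= n -> part_sum nu k = part_sum mu k.
  by move=> kn; rewrite -!card_row_of_lt // E.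
apply/val_inj/ffunP => r; apply/val_inj/eqP.
by rewrite -(eqn_add2l (part_sum nu r)) -part_sumS S // part_sumS S // ltnW.
Qed.

Lemma card_perm_pred (T : finType) (g : {perm T}) (P : pred T) :
  #|[pred x | P (g x)]| = #|P|.
Proof.
by rewrite -!sum1_card [RHS](reindex_inj (@perm_inj _ g)); apply: eq_bigl.
Qed.

(** * Young symmetrizers *)

Section YoungSymmetrizer.
Variables (F : numClosedFieldType) (n : nat).
Local Notation A := (galg F 'S_n).
Local Open Scope ring_scope.
Implicit Types (nu mu : partitions n) (g p q : 'S_n).

(** Only the tableau with entry [k] in cell [k] is used; the other tableaux enter through
    multiplication by group elements. *)
Definition row_group nu : {set 'S_n} :=
  [set p : 'S_n | [forall x, row_of nu (p x) == row_of nu x]].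
Definition col_group nu : {set 'S_n} :=
  [set p : 'S_n | [forall x, col_of nu (p x) == col_of nu x]].

Lemma row_groupP nu p :
  reflect (forall x, row_of nu (p x) = row_of nu x) (p \in row_group nu).
Proof. by rewrite inE; apply: 'forall_eqP. Qed.
Lemma col_groupP nu p :
  reflect (forall x, col_of nu (p x) = col_of nu x) (p \in col_group nu).
Proof. by rewrite inE; apply: 'forall_eqP. Qed.

Lemma row_group_set nu : group_set (row_group nu).
Proof.
apply/group_setP; split=> [|p q /row_groupP pr /row_groupP qr]; apply/row_groupP => x.
  by rewrite perm1.
by rewrite permM qr pr.
Qed.
Canonical row_group_group nu := Group (row_group_set nu).

Lemma col_group_set nu : group_set (col_group nu).
Proof.
apply/group_setP; split=> [|p q /col_groupP pr /col_groupP qr]; apply/col_groupP => x.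
  by rewrite perm1.
by rewrite permM qr pr.
Qed.
Canonical col_group_group nu := Group (col_group_set nu).

Definition rsym nu : A := \sum_(p in row_group nu) gel p.
Definition csym nu : A := \sum_(q in col_group nu) (-1) ^+ odd_perm q *: gel q.

Lemma gel_rsym nu p : p \in row_group nu -> gel p * rsym nu = rsym nu.
Proof.
move=> pr; rewrite mulr_sumr [RHS](reindex_inj (mulgI p)).
by apply: eq_big => [q|q _] /=; rewrite ?gelM ?groupMl.
Qed.

Lemma csym_gel nu q : q \in col_group nu -> csym nu * gel q = (-1) ^+ odd_perm q *: csym nu.
Proof.
move=> qr; rewrite mulr_suml scaler_sumr [RHS](reindex_inj (mulIg q)).
apply: eq_big => [p|p _] /=; rewrite ?groupMr //.
by rewrite -scalerAl gelM odd_permM signr_addb scalerA mulrCA -expr2 sqrr_sign mulr1.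
Qed.

Lemma rsym_star nu : gstar (rsym nu) = rsym nu.
Proof.
rewrite gstar_sum (reindex_inj invg_inj); apply: eq_big => [p|p _] /=.
  by rewrite groupV.
by rewrite gstar_gel invgK.
Qed.

Lemma csym_star nu : gstar (csym nu) = csym nu.
Proof.
rewrite gstar_sum (reindex_inj invg_inj); apply: eq_big => [p|p _] /=.
  by rewrite groupV.
by rewrite gstarZ gstar_gel invgK odd_permV rmorph_sign.
Qed.

Lemma rsym_sq nu : rsym nu * rsym nu = #|row_group nu|%:R *: rsym nu.
Proof.
rewrite {1}/rsym mulr_suml (eq_bigr (fun=> rsym nu)) => [|p]; last exact: gel_rsym.
by rewrite sumr_const scaler_nat.
Qed.

Lemma csym_sq nu : csym nu * csym nu = #|col_group nu|%:R *: csym nu.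
Proof.
rewrite {2}/csym mulr_sumr (eq_bigr (fun=> csym nu)) => [|q qC].
  by rewrite sumr_const scaler_nat.
by rewrite -scalerAr csym_gel // scalerA -expr2 sqrr_sign scale1r.
Qed.

(** For a violating pair, the transposition [t] of [x] and [y] is in the column group and [t ^ g] in
    the row group. Moving [t] through [g] shows that the product equals its own negative. *)
Lemma csym_gel_rsym_inj nu mu g :
  csym nu * gel g * rsym mu != 0 ->
  forall x y : 'I_n, col_of nu x = col_of nu y -> row_of mu (g x) = row_of mu (g y) -> x = y.
Proof.
move=> nz x y cxy rxy; apply/eqP; apply: contraNT nz => nxy.
set t := tperm x y.
have tC : t \in col_group nu.
  by apply/col_groupP => z; rewrite /t; case: tpermP => // ->.
have tR : (t ^ g)%g \in row_group mu.
  rewrite tpermJ; apply/row_groupP => z.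
  by case: tpermP => // ->.
have: csym nu * gel g * rsym mu = - (csym nu * gel g * rsym mu).
  rewrite -{1}(gel_rsym tR) -mulrA [gel g * _]mulrA gelM -conjgC -gelM.
  by rewrite !mulrA csym_gel // /t odd_tperm nxy expr1 scaleN1r !mulNr.
by move/eqP; rewrite -subr_eq0 opprK -mulr2n -(scaler_nat 2) scaler_eq0 pnatr_eq0.
Qed.

(** The labelling [rho] of the diagram of [nu] is here [row_of mu] after [g]. *)
Lemma csym_rsym_dominance nu mu g : csym nu * gel g * rsym mu != 0 ->
  forall k, (#|[pred x : 'I_n | row_of mu x < k]| <= #|[pred x : 'I_n | row_of nu x < k]|)%N.
Proof.
move/csym_gel_rsym_inj => inj k.
have /= := diagram_dominance (@cell_of_up _ nu) inj k.
by rewrite (card_perm_pred g (fun x => row_of mu x < k)%N).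
Qed.

(** If the product is nonzero, [diagram_rearrange] factors [g] as a column permutation [q] times a
    row permutation; the first is absorbed with its sign, the second without change. *)
Lemma csym_gel_rsym nu g : exists c, csym nu * gel g * rsym nu = c *: (csym nu * rsym nu).
Proof.
have [->|nz] := eqVneq (csym nu * gel g * rsym nu) 0.
  by exists 0; rewrite scale0r.
have [k|q qP] := diagram_rearrange (@cell_of_up _ nu) (csym_gel_rsym_inj nz).
  exact: (card_perm_pred g (fun x => row_of nu x < k)%N).
have qC : q \in col_group nu by apply/col_groupP => x; have [] := qP x.
have pR : (q^-1 * g)%g \in row_group nu.
  apply/row_groupP => x; rewrite permM; have [_ <-] := qP (q^-1%g x).
  by rewrite permKV.
exists ((-1) ^+ odd_perm q).
by rewrite -{1}(mulKVg q g) -gelM mulrA csym_gel // -!scalerAl -mulrA gel_rsym.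
Qed.

Lemma csym_mul_rsym nu x : exists c, csym nu * x * rsym nu = c *: (csym nu * rsym nu).
Proof.
rewrite (galgE x) [csym nu * _]mulr_sumr mulr_suml.
elim/big_rec: _ => [|g y _ [c ->]]; first by exists 0; rewrite scale0r.
have [d E] := csym_gel_rsym nu g.
by exists (x g * d + c); rewrite -scalerAr -scalerAl E scalerA scalerDl.
Qed.

Lemma csym_mul_rsym_eq0 nu mu x k :
  (#|[pred x : 'I_n | row_of nu x < k]| < #|[pred x : 'I_n | row_of mu x < k]|)%N ->
  csym nu * x * rsym mu = 0.
Proof.
move=> lt; rewrite (galgE x) [csym nu * _]mulr_sumr mulr_suml big1 // => g _.
rewrite -scalerAr -scalerAl; have [->|nz] := eqVneq (csym nu * gel g * rsym mu) 0.
  by rewrite scaler0.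
by have := csym_rsym_dominance nz k; rewrite leqNgt lt.
Qed.

Lemma rsym_mul_csym_eq0 nu mu x k :
  (#|[pred x : 'I_n | row_of nu x < k]| < #|[pred x : 'I_n | row_of mu x < k]|)%N ->
  rsym mu * x * csym nu = 0.
Proof.
move=> lt; apply: (can_inj (@gstarK _ _)).
by rewrite !gstarM csym_star rsym_star mulrA (csym_mul_rsym_eq0 _ lt) gstar0.
Qed.

Lemma rsymE nu g : rsym nu g = (g \in row_group nu)%:R.
Proof.
rewrite galg_sumE big_mkcond (bigD1 g) //= big1 => [|p pg]; last first.
  by case: ifP; rewrite // gelE eq_sym (negPf pg).
by case: ifP; rewrite addr0 ?gelE ?eqxx.
Qed.

Lemma csymE nu g : csym nu g = if g \in col_group nu then (-1) ^+ odd_perm g else 0.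
Proof.
rewrite galg_sumE big_mkcond (bigD1 g) //= big1 => [|p pg]; last first.
  by case: ifP; rewrite // galgZE gelE eq_sym (negPf pg) mulr0.
by case: ifP; rewrite addr0 ?galgZE ?gelE ?eqxx ?mulr1.
Qed.

(** A permutation preserving both rows and columns is trivial, so only one term contributes. *)
Lemma csym_rsym1E nu : (csym nu * rsym nu) 1%g = 1.
Proof.
rewrite galgME (bigD1 1%g) //= big1 => [|g g1].
  by rewrite addr0 invg1 mul1g rsymE csymE !group1 odd_perm1 mulr1.
rewrite mulg1 rsymE csymE groupV; case: ifP => [gC|]; last by rewrite mul0r.
case: (boolP (g \in row_group nu)) => [gR|]; last by rewrite mulr0.
case/eqP: g1; apply/permP => x; rewrite perm1.
by apply: (cell_of_inj (nu := nu)); [exact/row_groupP | exact/col_groupP].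
Qed.

Definition young nu : A := csym nu * rsym nu * csym nu.

Lemma young_star nu : gstar (young nu) = young nu.
Proof. by rewrite /young !gstarM csym_star rsym_star mulrA. Qed.

(** With [x = rsym nu * csym nu], the product [gstar x * x] is a multiple of [young nu]. So
    [young nu = 0] would give [x = 0], but [gstar x] has coefficient 1 at the identity. *)
Lemma young_neq0 nu : young nu != 0.
Proof.
apply/eqP => y0; have /gstar_mul_eq0 : gstar (rsym nu * csym nu) * (rsym nu * csym nu) = 0.
  rewrite gstarM csym_star rsym_star !mulrA -[_ * rsym nu * rsym nu]mulrA rsym_sq.
  by rewrite -scalerAr -scalerAl [_ * _]y0 scaler0.
move=> /(congr1 (@gstar _ _)); rewrite gstarM csym_star rsym_star gstar0.
by move/galgP/(_ 1%g)/eqP; rewrite csym_rsym1E galg0E oner_eq0.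
Qed.

Lemma young_prim nu x : exists c, young nu * x * young nu = c *: young nu.
Proof.
have [c cE] := csym_mul_rsym nu (x * csym nu).
have [d dE] := csym_mul_rsym nu (rsym nu * csym nu).
exists (c * d); rewrite /young.
transitivity (csym nu * rsym nu * (csym nu * (x * csym nu) * rsym nu) * csym nu).
  by rewrite !mulrA.
rewrite cE -scalerAr -scalerAl -scalerA; congr (_ *: _).
by rewrite scalerAl -dE !mulrA.
Qed.

(** Here [k] is the scalar by which [csym nu * rsym nu] squares to a multiple of itself; if it were
    0, [young nu * young nu] would vanish. Up to [k], right multiplications by [young nu] and by
    [rsym nu] pass back and forth between the left ideals of [csym nu * rsym nu] and [young nu]. *)
Lemma csym_rsym_young nu : exists2 k, k != 0 &
  (csym nu * rsym nu) * young nu = k *: young nu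
  /\ young nu * rsym nu = k *: (csym nu * rsym nu).
Proof.
have [k kE] := csym_mul_rsym nu (rsym nu * csym nu).
have yr : young nu * rsym nu = k *: (csym nu * rsym nu) by rewrite -kE /young !mulrA.
exists k; last split=> //; last by rewrite /young !mulrA yr -scalerAl.
apply/eqP => k0; have /gstar_mul_eq0/eqP : gstar (young nu) * young nu = 0.
  rewrite young_star.
  transitivity (csym nu * rsym nu * (csym nu * csym nu) * rsym nu * csym nu).
    by rewrite /young !mulrA.
  by rewrite csym_sq -scalerAr -!scalerAl -/(young nu) yr k0 scale0r mul0r scaler0.
by rewrite (negPf (young_neq0 nu)).
Qed.

Lemma mul_csym_rsym_young nu : exists2 k, k != 0 &
  forall x, x * (csym nu * rsym nu) * young nu = k *: (x * young nu).
Proof.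
have [k k0 [ky _]] := csym_rsym_young nu; exists k => // x.
by rewrite -mulrA ky -scalerAr.
Qed.

(** The numbers of cells in the first [k] rows differ for some [k]. One sign kills the factor from
    [csym nu] to [rsym mu], the other the factor from [rsym nu] to [csym mu]. *)
Lemma young_orth nu mu x : nu != mu -> young nu * x * young mu = 0.
Proof.
move=> ne; have: [exists k : 'I_n.+1, #|[pred x : 'I_n | row_of nu x < k]|
   != #|[pred x : 'I_n | row_of mu x < k]| :> nat]%N.
  apply: contraNT ne; rewrite negb_exists => /forallP eqk.
  apply/eqP/partition_eq => k kn.
  by have := eqk (Ordinal (kn : k < n.+1)%N); rewrite negbK => /eqP.
case/existsP => k; rewrite neq_ltn => /orP[] lt; rewrite /young.
  have := csym_mul_rsym_eq0 (x * csym mu) lt; rewrite !mulrA => E.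
  transitivity (csym nu * rsym nu * (csym nu * x * csym mu * rsym mu) * csym mu).
    by rewrite !mulrA.
  by rewrite E mulr0 mul0r.
have := rsym_mul_csym_eq0 (csym nu * x) lt; rewrite !mulrA => E.
transitivity (csym nu * (rsym nu * csym nu * x * csym mu) * rsym mu * csym mu).
  by rewrite !mulrA.
by rewrite E mulr0 !mul0r.
Qed.

End YoungSymmetrizer.

(** * Cycle types and completeness *)

Section Conjugacy.
Variable T : finType.
Implicit Types (s t : {perm T}) (x y : T).
Local Open Scope group_scope.

Lemma perm_pow_mod s x i : (s ^+ i) x = (s ^+ (i %% #|porbit s x|)) x.
Proof.
rewrite {1}(divn_eq i #|porbit s x|) addnC expgD permM !permX.
set y := iter _ s x; have -> : #|porbit s x| = #|porbit s y|.
  by rewrite /y -permX porbit_perm.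
elim: (i %/ _) => //= k IH; rewrite mulSn addnC iterD iter_porbit.
exact: IH.
Qed.

Lemma perm_pow_eq s x i j :
  ((s ^+ i) x == (s ^+ j) x) = (i == j %[mod #|porbit s x|]).
Proof.
have k0 : 0 < #|porbit s x| by rewrite lt0n card_porbit_neq0.
rewrite (perm_pow_mod s x i) (perm_pow_mod s x j) !permX.
have lt l : l %% #|porbit s x| < #|porbit s x| by rewrite ltn_mod.
rewrite -(nth_traject s (lt i)) -(nth_traject s (lt j)).
by rewrite nth_uniq ?size_traject ?ltn_mod ?uniq_traject_porbit.
Qed.

Lemma perm_conj s t :
  (forall k : nat, #|[set o in porbits s | #|o| == k]| = #|[set o in porbits t | #|o| == k]|) ->
  exists p : {perm T}, t = s ^ p.
Proof.
move=> eqk.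
pose P s (k : nat) := [set o in porbits s | #|o| == k].
have Pe k : size (enum (P t k)) = size (enum (P s k)) by rewrite -!cardE /P eqk.
(* The match of [o] has the same position as [o] in the enumeration of the cycles of its length. *)
pose b (o : {set T}) := nth set0 (enum (P t #|o|)) (index o (enum (P s #|o|))).
have ordP o : o \in porbits s -> o \in P s #|o| by move=> os; rewrite inE os eqxx.
have bP o : o \in porbits s -> b o \in P t #|o|.
  move=> os; rewrite -mem_enum mem_nth // Pe index_mem mem_enum.
  exact: ordP.
have b_card o : o \in porbits s -> #|b o| = #|o|.
  by move=> /bP; rewrite inE => /andP[_ /eqP].
have b_inj : {in porbits s &, injective b}.
  move=> o o' os os' bb.
  have ooc : #|o| = #|o'| by rewrite -b_card // bb b_card.
  move: bb; rewrite /b ooc => /eqP; rewrite nth_uniq ?enum_uniq //; first last.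
  - by rewrite Pe index_mem mem_enum ordP.
  - by rewrite Pe index_mem mem_enum -ooc ordP.
  move=> /eqP /(congr1 (nth set0 (enum (P s #|o'|)))).
  by rewrite !nth_index ?mem_enum ?ordP // -ooc ordP.
(* Base points are heads of enumerations; the default is irrelevant on nonempty sets, so they depend
   on the cycle alone. *)
have hd (A : {set T}) x y z : z \in A -> head x (enum A) = head y (enum A).
  by rewrite -mem_enum; case: (enum A).
have hdin (A : {set T}) x z : z \in A -> head x (enum A) \in A.
  by rewrite -!(mem_enum A); case: (enum A) => //= a l _; rewrite mem_head.
pose r x := head x (enum (porbit s x)).
pose r' x := head x (enum (b (porbit s x))).
have os x : porbit s x \in porbits s by apply: imset_f.
have r_in x : r x \in porbit s x by apply: hdin (porbit_id s x).
have b_ne x : exists z, z \in b (porbit s x).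
  by apply/card_gt0P; rewrite b_card // lt0n card_porbit_neq0.
have r'_in x : r' x \in b (porbit s x) by have [z zb] := b_ne x; apply: hdin zb.
have r_orb x : porbit s (r x) = porbit s x by apply/eqP; rewrite eq_porbit_mem.
have r'_orb x : porbit t (r' x) = b (porbit s x).
  have := bP _ (os x); rewrite inE => /andP[/imsetP[y _ by_] _].
  by rewrite by_; apply/eqP; rewrite eq_porbit_mem -by_.
have rr' x : #|porbit s (r x)| = #|porbit t (r' x)|.
  by rewrite r_orb r'_orb b_card.
have idx x : exists i, (s ^+ i) (r x) == x.
  have /porbitP[i ix] : x \in porbit s (r x) by rewrite r_orb porbit_id.
  by exists i; rewrite -ix.
(* The exponent is an arbitrary choice; [fP] shows that any other gives the same value, as matched
   cycles have equal length. *)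
pose f x := (t ^+ xchoose (idx x)) (r' x).
have fP i x : (s ^+ i) (r x) = x -> f x = (t ^+ i) (r' x).
  move=> ix; apply/eqP; rewrite /f perm_pow_eq -rr' -perm_pow_eq.
  by rewrite ix; exact: (xchooseP (idx x)).
have same x y : porbit s x = porbit s y -> r x = r y /\ r' x = r' y.
  move=> xy; have [z zb] := b_ne y; rewrite /r /r' xy.
  by rewrite (hd _ x y _ (porbit_id s y)) (hd _ x y _ zb).
have f_inj : injective f.
  move=> x y; have /eqP ix := xchooseP (idx x); have /eqP iy := xchooseP (idx y).
  rewrite (fP _ _ ix) (fP _ _ iy) => fxy.
  have oxy : porbit s x = porbit s y.
    apply: b_inj => //; rewrite -!r'_orb.
    rewrite -(porbit_perm t (xchoose (idx x))) -[RHS](porbit_perm t (xchoose (idx y))).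
    by rewrite fxy.
  have [rxy r'xy] := same _ _ oxy; move/eqP: fxy.
  by rewrite r'xy perm_pow_eq -rr' -perm_pow_eq -{1}rxy ix iy => /eqP.
exists (perm f_inj); apply/permP => y.
rewrite -[y](permKV (perm f_inj)); set x := (perm f_inj)^-1 y.
rewrite conjgE !permM permK !permE.
have /eqP ix := xchooseP (idx x).
have oxs : porbit s x = porbit s (s x).
  by have := porbit_perm s 1 x; rewrite expg1.
have [rx r'x] := same _ _ oxs.
rewrite (fP _ _ ix) (fP (xchoose (idx x)).+1 (s x)) -?r'x.
  by rewrite expgSr permM.
by rewrite -rx expgSr permM ix.
Qed.

End Conjugacy.

(** * Cycle types as partitions *)

Section CycleType.
Variable n : nat.
Implicit Types (g h : 'S_n).

Let big_cycles g k := [set o in porbits g | k < #|o|].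

Lemma card_big_cycles g k : #|big_cycles g k| < n.+1.
Proof.
rewrite ltnS -[leqRHS]card_ord (leq_trans _ (leq_imset_card (porbit g) 'I_n)) //.
by apply: subset_leq_card; apply/subsetP => o; rewrite inE => /andP[].
Qed.

Lemma sum_porbits g : \sum_(o in porbits g) #|o| = n.
Proof.
rewrite -[RHS]card_ord -sum1_card.
rewrite (partition_big (porbit g) (mem (porbits g))) /= => [|x _]; last exact: imset_f.
apply: eq_bigr => _ /imsetP[y _ ->]; rewrite -sum1_card; apply: eq_bigl => x.
by rewrite eq_porbit_mem.
Qed.

(* The transpose of the usual cycle type, which needs no sorting. *)
Definition cycle_fun g : {ffun 'I_n -> 'I_n.+1} :=
  [ffun i : 'I_n => Ordinal (card_big_cycles g i)].

(** The total is found by double counting: a cycle [o] is counted once for each [i < #|o|], and the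
    cycle lengths add up to [n]. *)
Lemma cycle_fun_partition g : is_partition (cycle_fun g).
Proof.
apply/andP; split.
  apply/forallP => i; apply/forallP => j; apply/implyP => ij; rewrite !ffunE /=.
  apply: subset_leq_card; apply/subsetP => o; rewrite !inE => /andP[-> jo].
  exact: leq_ltn_trans jo.
apply/eqP; rewrite -[RHS](sum_porbits g).
rewrite (eq_bigr (fun i : 'I_n => \sum_(o in porbits g) (i < #|o|))) => [|i _].
  rewrite exchange_big; apply: eq_bigr => o _.
  rewrite -big_mkcond sum1_card card_ord_lt //.
  by rewrite -[leqRHS]card_ord max_card.
rewrite ffunE /= -sum1_card [LHS]big_mkcond [RHS]big_mkcond /=.
apply: eq_bigr => o _.
by rewrite inE; case: (o \in _) => //=; case: (_ < _).
Qed.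

Definition cycle_type g : partitions n := Sub (cycle_fun g) (cycle_fun_partition g).

(** The number of cycles of length [k + 1] is the difference of two consecutive counts of long
    cycles, and beyond [n] these counts are 0 for every permutation. *)
Lemma cycle_type_conj g h : cycle_type g = cycle_type h -> exists p, h = (g ^ p)%g.
Proof.
move=> gh.
have eqb k : #|big_cycles g k| = #|big_cycles h k|.
  case: (ltnP k n) => kn.
    have /(congr1 val)/ffunP/(_ (Ordinal kn)) := gh.
    by rewrite !ffunE => /(congr1 val).
  suff b0 s : #|big_cycles s k| = 0 by rewrite !b0.
  apply: eq_card0 => o; rewrite inE; apply/negbTE; rewrite negb_and -leqNgt orbC.
  by rewrite (leq_trans _ kn) // -[leqRHS]card_ord max_card.
apply: perm_conj => -[|k].
  suff b0 (s : 'S_n) : #|[set o in porbits s | #|o| == 0]| = 0 by rewrite !b0.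
  apply: eq_card0 => o; rewrite inE; apply/negbTE; rewrite negb_and.
  case: imsetP => //= -[x _ ->]; exact: card_porbit_neq0.
have split (s : 'S_n) : #|big_cycles s k| =
    #|[set o in porbits s | #|o| == k.+1]| + #|big_cycles s k.+1|.
  rewrite -cardsUI (_ : _ :&: _ = set0).
    rewrite cards0 addn0; apply: eq_card => o; rewrite !inE -andb_orr.
    by rewrite eq_sym leq_eqVlt.
  by apply/setP => o; rewrite !inE; case: eqP => [->|]; rewrite ?ltnn ?andbF.
by apply/eqP; rewrite -(eqn_add2r #|big_cycles g k.+1|) -split eqb split eqb.
Qed.

End CycleType.

(** * The unit as a combination of averaged Young elements *)

Section Completeness.
Variables (F : numClosedFieldType) (n : nat).
Local Notation A := (galg F 'S_n).
Local Open Scope ring_scope.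
Let zy (nu : partitions n) : A := gavg (young F nu).

Let zy_orth nu mu : nu != mu -> zy nu * zy mu = 0.
Proof.
move=> ne; rewrite /zy /gavg big_distrlr big1 //= => h _; rewrite big1 // => g _.
transitivity (gel h * (young F nu * (gel h^-1 * gel g) * young F mu) * gel g^-1).
  by rewrite !mulrA.
by rewrite young_orth // mulr0 mul0r.
Qed.

Let zy_sq nu : zy nu * zy nu != 0.
Proof.
apply/eqP => z0; have /gstar_mul_eq0 : gstar (zy nu) * zy nu = 0.
  by rewrite gavg_star // young_star.
move/galgP/(_ 1%g)/eqP; rewrite gavg1E galg0E mulf_eq0 pnatr_eq0.
rewrite -[_ == _ :> nat]negbK -lt0n; have -> /= : (0 < #|'S_n|)%N by apply/card_gt0P; exists 1%g.
apply/negP; apply: (@corner_unit_neq0 F _ (young F nu)).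
- exact: young_star.
- exact: young_neq0.
- exact: young_prim.
Qed.

Lemma young_complete :
  exists c : partitions n -> F, 1 = \sum_nu c nu *: gavg (young F nu) :> A.
Proof.
pose N := #|{: partitions n}|.
(* The default 0 is taken at partitions that are not known to be cycle types; with it [Y] is square,
   indexed by partitions on both sides. *)
pose val_at (f : A) mu := if [pick g | cycle_type g == mu] is Some g then f g else 0.
have val_atE (f : A) g : (forall a b, f (a ^ b)%g = f a) -> val_at f (cycle_type g) = f g.
  move=> f_class; rewrite /val_at; case: pickP => [h /eqP|/(_ g)/eqP//].
  by move/cycle_type_conj => [p ->]; rewrite f_class.
pose Y : 'M[F]_N := \matrix_(i, j) val_at (zy (enum_val i)) (enum_val j).
have rowE (v : 'rV[F]_N) g :
    (v *m Y) 0 (enum_rank (cycle_type g)) = (\sum_i v 0 i *: zy (enum_val i)) g.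
  rewrite !mxE galg_sumE; apply: eq_bigr => i _; rewrite mxE enum_rankK galgZE.
  by rewrite val_atE // => a b; rewrite gavg_class.
(* Multiplying a linear relation by one [zy] isolates its coefficient, by [zy_orth] and [zy_sq]. *)
have freeY : row_free Y.
  apply/row_freeP/row_freeP; rewrite -kermx_eq0; apply/rowV0P => v /sub_kermxP vY.
  have s0 : \sum_i v 0 i *: zy (enum_val i) = 0.
    by apply/galgP => g; rewrite -rowE vY mxE galg0E.
  apply/rowP => i; rewrite mxE.
  have := congr1 (fun x => x * zy (enum_val i)) s0.
  rewrite mul0r mulr_suml (bigD1 i) //= big1 ?addr0 => [|j ji].
    by rewrite -scalerAl => /eqP; rewrite scaler_eq0 (negPf (zy_sq _)) orbF => /eqP.
  by rewrite -scalerAl zy_orth ?scaler0 // (inj_eq enum_val_inj).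
have unitY : Y \in unitmx by rewrite -row_free_unit.
(* The indicator of the cycle type of the identity, that is, the unit as a class function. *)
pose d : 'rV[F]_N := \row_j (j == enum_rank (cycle_type (1%g : 'S_n)))%:R.
pose v := d *m invmx Y.
exists (fun nu => v 0 (enum_rank nu)); apply/galgP => g.
have -> : \sum_nu v 0 (enum_rank nu) *: gavg (young F nu) = \sum_i v 0 i *: zy (enum_val i).
  rewrite [RHS](reindex _ (onW_bij _ (@enum_rank_bij (partitions n)))) /=.
  by apply: eq_bigr => nu _; rewrite enum_rankK.
rewrite -rowE mulmxKV // mxE -[1]/(gel 1%g) gelE (inj_eq enum_rank_inj); congr (nat_of_bool _)%:R.
apply/esym; case: (eqVneq g 1%g) => [->|]; rewrite ?eqxx //.
apply: contraNF => /eqP /esym /cycle_type_conj [p ->].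
by rewrite conj1g.
Qed.

End Completeness.

(** * The tensor power *)

Local Open Scope ring_scope.

Section TensorAction.
Variables (R : realType) (n : nat).
Local Notation C := (R[i]).
Local Notation T := {mpoly C[n]}.
Implicit Types (p q : T) (m : 'X_{1..n}) (j : 'I_n) (s g h : 'S_n).

(** Summing up to a degree bound instead of over the support lets several polynomials share one
    index set, as linearity requires. *)
Lemma mlinE (f : 'X_{1..n} -> T) p k : (msize p <= k)%N ->
  mlin f p = \sum_(m : 'X_{1..n < k}) p@_m *: f m.
Proof.
move=> lt_pk; pose I : subFinType _ := 'X_{1..n < k}.
rewrite /mlin (big_mksub I) ?msupp_uniq //=; first last.
  by move=> x /msize_mdeg_lt /leq_trans; apply.
by rewrite big_rmcond //= => i; move/memN_msupp_eq0 ->; rewrite scale0r.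
Qed.

Lemma mlin_is_linear (f : 'X_{1..n} -> T) : linear (mlin f : T -> T).
Proof.
move=> a p q; pose k := maxn (msize (a *: p + q)) (maxn (msize p) (msize q)).
rewrite !(@mlinE f _ k) ?leq_max ?leqnn ?orbT //.
rewrite scaler_sumr -big_split /=; apply: eq_bigr => m _.
by rewrite mcoeffD mcoeffZ scalerDl scalerA.
Qed.
HB.instance Definition _ (f : 'X_{1..n} -> T) :=
  GRing.isLinear.Build C T T *:%R (mlin f : T -> T) (mlin_is_linear f).

Lemma mlinX (f : 'X_{1..n} -> T) m : mlin f 'X_[m] = f m.
Proof. by rewrite /mlin msuppX big_seq1 mcoeffX eqxx scale1r. Qed.

Lemma linear_mpoly_ext (V : zmodType) (sc : GRing.Scale.law C V) (f g : {linear T -> V | sc}) :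
  (forall m, f 'X_[m] = g 'X_[m]) -> f =1 g.
Proof.
move=> fg p; rewrite (mpolyE p) !linear_sum; apply: eq_bigr => m _.
by rewrite !linearZ_LR /= fg.
Qed.

Definition mcomp m s : 'X_{1..n} := [multinom m (s i) | i < n].

Lemma mcompM m s t : mcomp (mcomp m s) t = mcomp m (t * s)%g.
Proof. by apply/mnmP => i; rewrite !mnmE permM. Qed.
Lemma mcomp1 m : mcomp m 1%g = m.
Proof. by apply/mnmP => i; rewrite !mnmE perm1. Qed.

HB.instance Definition _ s := GRing.Linear.copy (perm_act s : T -> T)
  (mlin (fun m => 'X_[[multinom m (s^-1 i)%g | i < n]]) : T -> T).

Lemma perm_actX s m : perm_act s ('X_[m] : tens R n) = 'X_[mcomp m s^-1%g].
Proof. exact: mlinX. Qed.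

Lemma perm_act_mul s t p : perm_act s (perm_act t p) = perm_act (t * s)%g p.
Proof.
apply: (linear_mpoly_ext (f := perm_act s \o perm_act t)) => m /=.
by rewrite !perm_actX mcompM invMg.
Qed.

Lemma perm_act1 p : perm_act 1%g p = p.
Proof.
apply: (linear_mpoly_ext (f := perm_act 1%g) (g := idfun)) => m /=.
by rewrite perm_actX invg1 mcomp1.
Qed.

Lemma mcoeff_perm_act s p m : (perm_act s p)@_m = p@_(mcomp m s).
Proof.
apply: (linear_mpoly_ext (f := mcoeff m \o perm_act s) (g := mcoeff (mcomp m s))) => k /=.
rewrite perm_actX !mcoeffX; congr (nat_of_bool _)%:R.
by apply/eqP/eqP => [<-|->]; rewrite mcompM ?mulgV ?mulVg mcomp1.
Qed.

(* [perm_act] is a left action for [s o t = (t * s)%g], hence the inverse. *)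
Definition gact (x : galg C 'S_n) p : T := \sum_g x g *: perm_act g^-1%g p.

Lemma gact_is_linear x : linear (gact x).
Proof.
move=> a p q; rewrite /gact scaler_sumr -big_split /=; apply: eq_bigr => g _.
by rewrite linearD linearZ /= scalerDr !scalerA mulrC.
Qed.
HB.instance Definition _ x := GRing.isLinear.Build C T T *:%R (gact x) (gact_is_linear x).

Lemma gactD x y p : gact (x + y) p = gact x p + gact y p.
Proof.
by rewrite /gact -big_split /=; apply: eq_bigr => g _; rewrite galgDE scalerDl.
Qed.

Lemma gactZ a x p : gact (a *: x) p = a *: gact x p.
Proof.
by rewrite /gact scaler_sumr; apply: eq_bigr => g _; rewrite galgZE scalerA.
Qed.

Lemma gact0 p : gact 0 p = 0.
Proof. by rewrite /gact big1 // => g _; rewrite galg0E scale0r. Qed.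

Lemma gact_sum (I : Type) (r : seq I) (P : pred I) (f : I -> galg C 'S_n) p :
  gact (\sum_(i <- r | P i) f i) p = \sum_(i <- r | P i) gact (f i) p.
Proof. exact: (big_morph (gact^~ p) (fun x y => gactD x y p) (gact0 p)). Qed.

Lemma gact_gel g p : gact (gel g) p = perm_act g^-1%g p.
Proof.
rewrite /gact (bigD1 g) //= big1 => [|h hg]; rewrite gelE ?eqxx ?scale1r ?addr0 //.
by rewrite (negPf hg) scale0r.
Qed.

Lemma gactM x y p : gact (x * y) p = gact x (gact y p).
Proof.
rewrite {1}(galgE x) mulr_suml gact_sum; apply: eq_bigr => g _.
rewrite -scalerAl gactZ; congr (_ *: _).
rewrite {1}(galgE y) mulr_sumr gact_sum {2}/gact linear_sum.
apply: eq_bigr => h _; rewrite -scalerAr gactZ gelM gact_gel linearZ /=; congr (_ *: _).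
by rewrite [RHS]perm_act_mul invMg.
Qed.

Lemma gact1 p : gact 1 p = p.
Proof. by rewrite -gel1 gact_gel invg1 perm_act1. Qed.

Section GlAction.
Variable lam : C.

Lemma factor_word_is_linear j w : linear (factor_word lam j w : T -> T).
Proof.
elim: w => [//|g w IH] a p q; rewrite [LHS]/= [factor_word _ _ _ _]IH.
by rewrite [LHS]mlin_is_linear.
Qed.
HB.instance Definition _ j w :=
  GRing.isLinear.Build C T T *:%R (factor_word lam j w : T -> T) (factor_word_is_linear j w).

Lemma gl_act_is_linear w : linear (gl_act lam w : T -> T).
Proof.
move=> a p q; rewrite /gl_act scaler_sumr -big_split /=; apply: eq_bigr => j _.
exact: factor_word_is_linear.
Qed.
HB.instance Definition _ w :=
  GRing.isLinear.Build C T T *:%R (gl_act lam w : T -> T) (gl_act_is_linear w).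

Definition mset j k m : 'X_{1..n} := [multinom (if i == j then k else m i) | i < n].

Lemma mcomp_mset j k m s : mcomp (mset j k m) s = mset (s^-1%g j) k (mcomp m s).
Proof.
by apply/mnmP => i; rewrite !mnmE (can2_eq (permK s) (permKV s)).
Qed.

Lemma factor_genE j (g : sl2gen) m :
  factor_gen lam j g m = (verma_basis_act lam g (m j)).1 *:
     'X_[mset j (verma_basis_act lam g (m j)).2 m].
Proof. by rewrite /factor_gen; case: (verma_basis_act _ _ _). Qed.

Lemma perm_act_factor_word s j w p :
  perm_act s (factor_word lam j w p) = factor_word lam (s j) w (perm_act s p).
Proof.
elim: w p => //= g w IH p; rewrite -IH; move: (factor_word _ _ _ _) => {}p.
apply: (linear_mpoly_ext (f := perm_act s \o mlin (factor_gen lam j g))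
   (g := mlin (factor_gen lam (s j) g) \o perm_act s)) => m /=.
rewrite mlinX perm_actX mlinX !factor_genE linearZ /= [perm_act _ _]perm_actX.
by rewrite mcomp_mset invgK mnmE permK.
Qed.

Lemma perm_act_gl_act s w p : perm_act s (gl_act lam w p) = gl_act lam w (perm_act s p).
Proof.
rewrite /gl_act linear_sum [RHS](reindex_inj (@perm_inj _ s)).
by apply: eq_bigr => j _; exact: perm_act_factor_word.
Qed.

Lemma gact_gl_act x w p : gact x (gl_act lam w p) = gl_act lam w (gact x p).
Proof.
rewrite /gact linear_sum; apply: eq_bigr => g _.
by rewrite linearZ /= perm_act_gl_act.
Qed.

End GlAction.
End TensorAction.

(** * Density of gl(lambda) *)

Section Subspace.
Variables (R : realType) (n : nat).
Variable W : tens R n -> Prop.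
Hypothesis W_sub : is_subspace W.

Lemma subspaceZ a p : W p -> W (a *: p).
Proof. by case: W_sub => W0 WL Wp; rewrite -[_ *: _]addr0; apply: WL. Qed.

Lemma subspace_sum (I : Type) (r : seq I) (P : pred I) (f : I -> tens R n) :
  (forall i, P i -> W (f i)) -> W (\sum_(i <- r | P i) f i).
Proof.
case: W_sub => W0 WL Wf; elim/big_rec: _ => // i p Pi Wp.
by rewrite -[f i]scale1r; apply: WL => //; apply: Wf.
Qed.

End Subspace.

(** * Matrix units obtained from sl(2) words *)

Section MatrixUnits.
Variables (R : realType) (n : nat).
Local Notation C := (R[i]).
Local Notation T := {mpoly C[n]}.
Implicit Types (p q u : T) (m : 'X_{1..n}) (j : 'I_n).

(** The matrix unit in the basis [Y^i v] of the [j]-th factor that takes index [k] to [k']. *)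
Definition munit j k' k : T -> T :=
  mlin (fun m => if m j == k then 'X_[mset j k' m] else 0).

HB.instance Definition _ j k' k := GRing.Linear.copy (munit j k' k)
  (mlin (fun m => if m j == k then 'X_[mset j k' m] else 0) : T -> T).

Lemma munitX j k' k m : munit j k' k 'X_[m] = if m j == k then 'X_[mset j k' m] else 0.
Proof. exact: mlinX. Qed.

Lemma mset_set j k k' m : mset j k (mset j k' m) = mset j k m.
Proof. by apply/mnmP => i; rewrite !mnmE; case: (i == j). Qed.

Lemma mset_id j m : mset j (m j) m = m.
Proof. by apply/mnmP => i; rewrite !mnmE; case: eqP => [->|]. Qed.

Lemma mset_at j k m : mset j k m j = k. Proof. by rewrite mnmE eqxx. Qed.

Lemma mcoeff_munit j k' k p m :
  (munit j k' k p)@_m = if m j == k' then p@_(mset j k m) else 0.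
Proof.
(* With the condition as a scalar, both sides are linear in [p] and can be compared on monomials. *)
pose c : C := (m j == k')%:R.
have -> : (if m j == k' then p@_(mset j k m) else 0) = c * p@_(mset j k m).
  by rewrite /c; case: ifP; rewrite ?mul1r ?mul0r.
rewrite -mcoeffZ.
apply: (linear_mpoly_ext (f := mcoeff m \o munit j k' k)
  (g := mcoeff (mset j k m) \o ( *:%R c))) => q /=.
rewrite munitX mcoeffZ mcoeffX (fun_if (mcoeff m)) mcoeffX mcoeff0 /c.
case: (eqVneq (m j) k') => [mj|mj]; rewrite ?mul1r ?mul0r.
  case: (eqVneq (q j) k) => [qj|qj].
    congr (nat_of_bool _)%:R; apply/eqP/eqP => [<-|->].
      by rewrite mset_set -qj mset_id.
    by rewrite mset_set -mj mset_id.
  by case: eqP => // qE; rewrite qE mset_at eqxx in qj.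
case: eqP => // _; case: eqP => // mE.
by rewrite -mE mset_at eqxx in mj.
Qed.

Variable lam : C.

Lemma factor_word_cat j w1 w2 p :
  factor_word lam j (w1 ++ w2) p = factor_word lam j w1 (factor_word lam j w2 p).
Proof. exact: foldr_cat. Qed.

Definition hweight (k : nat) : C := lam - 1 - (2 * k)%:R.

Lemma factor_word_H j i m :
  factor_word lam j (nseq i gH) 'X_[m] = hweight (m j) ^+ i *: 'X_[m].
Proof.
elim: i => [|i IH]; first by rewrite scale1r.
rewrite [LHS]/= IH linearZ /= mlinX factor_genE /= mset_id scalerA.
by rewrite exprSr.
Qed.

Lemma factor_word_Y j d m :
  factor_word lam j (nseq d gY) 'X_[m] = 'X_[mset j (m j + d) m].
Proof.
elim: d => [|d IH]; first by rewrite addn0 mset_id.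
by rewrite [LHS]/= IH mlinX factor_genE /= scale1r mset_set mset_at addnS.
Qed.

Lemma factor_word_X j d m : (d <= m j)%N ->
  factor_word lam j (nseq d gX) 'X_[m] =
  (\prod_(i < d) ((m j - i)%:R * (lam - (m j - i)%:R))) *: 'X_[mset j (m j - d) m].
Proof.
elim: d => [|d IH] dm; first by rewrite big_ord0 scale1r subn0 mset_id.
rewrite [LHS]/= IH ?(ltnW dm) // linearZ /= mlinX factor_genE mset_set mset_at.
have [k kE] : exists k, (m j - d)%N = k.+1.
  by exists (m j - d.+1)%N; rewrite -subSn.
rewrite kE /= scalerA big_ord_recr /= kE.
by congr (_ *: 'X_[mset j _ m]); rewrite subnS kE.
Qed.

Hypothesis hlam : forall k : nat, k != 0%N -> lam != k%:R.

Lemma word_move (k' k : nat) : exists w c, c != 0 /\ forall j m, m j = k ->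
  factor_word lam j w 'X_[m] = c *: 'X_[mset j k' m].
Proof.
have [kk|kk] := leqP k k'.
  exists (nseq (k' - k) gY), 1; split; first exact: oner_neq0.
  by move=> j m mj; rewrite factor_word_Y mj subnKC // scale1r.
exists (nseq (k - k') gX), (\prod_(i < k - k') ((k - i)%:R * (lam - (k - i)%:R))).
split=> [|j m mj]; last by rewrite factor_word_X mj ?leq_subr // subKn // ltnW.
apply/prodf_neq0 => i _.
have ki : (k - i)%N != 0%N.
  by rewrite subn_eq0 -ltnNge (leq_trans (ltn_ord i)) ?leq_subr.
by rewrite mulf_neq0 ?pnatr_eq0 // subr_eq0 hlam.
Qed.

(** Lagrange interpolation; the weights are distinct because they differ by nonzero even
    integers. *)
Lemma hweight_interpolation N k : exists Q : {poly C},
  forall l, (l < N)%N -> Q.[hweight l] = (l == k)%:R.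
Proof.
exists (\prod_(l < N | l != k :> nat) ((hweight k - hweight l)^-1 *: ('X - (hweight l)%:P))).
move=> l lN; rewrite horner_prod; have [->|lk] := eqVneq l k.
  rewrite big1 // => i ik; rewrite hornerZ hornerXsubC mulVf //.
  rewrite subr_eq0 /hweight (inj_eq (addrI _)) eqr_opp eqr_nat.
  by rewrite eqn_pmul2l // eq_sym.
by rewrite (bigD1 (Ordinal lN)) //= hornerZ hornerXsubC subrr mulr0 mul0r.
Qed.

Variable W : tens R n -> Prop.
Hypotheses (W_sub : is_subspace W) (W_gl : gl_invariant lam W).

(** A polynomial in H, acting first, keeps only exponent [k] in the chosen factor, and the word of
    [word_move] then carries it to [k']. Interpolation up to [msize u] covers every exponent in
    [u]. *)
Lemma gl_munit k' k u : W u -> W (\sum_j munit j k' k u).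
Proof.
move=> Wu; have [w [c [c0 wE]]] := word_move k' k.
have [Q QE] := hweight_interpolation (msize u) k.
have -> : \sum_j munit j k' k u =
    c^-1 *: \sum_(i < size Q) Q`_i *: gl_act lam (w ++ nseq i gH) u.
  rewrite /gl_act; under [in RHS]eq_bigr => i _ do rewrite scaler_sumr.
  rewrite [in RHS]exchange_big [RHS]scaler_sumr; apply: eq_bigr => j _ /=.
  have linE (f : {linear T -> T}) : f u = \sum_(m <- msupp u) u@_m *: f 'X_[m].
    by rewrite {1}(mpolyE u) linear_sum; apply: eq_bigr => m _; rewrite linearZ.
  rewrite [LHS]linE.
  under [in RHS]eq_bigr => i _ do rewrite [factor_word _ _ _ _]linE scaler_sumr.
  rewrite [in RHS]exchange_big [RHS]scaler_sumr /=; apply: eq_big_seq => m mu.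
  have -> : \sum_(i < size Q) Q`_i *: (u@_m *: factor_word lam j (w ++ nseq i gH) 'X_[m])
      = u@_m *: (Q.[hweight (m j)] *: factor_word lam j w 'X_[m]).
    rewrite horner_coef [X in _ *: X]scaler_suml [RHS]scaler_sumr; apply: eq_bigr => i _.
    rewrite factor_word_cat factor_word_H [factor_word _ _ _ _]linearZ /= !scalerA.
    by rewrite mulrA (mulrC u@_m).
  rewrite QE; last first.
    apply: leq_ltn_trans (msize_mdeg_lt mu).
    by rewrite mdegE (bigD1 j) //= leq_addr.
  rewrite munitX; case: eqP => mj; last by rewrite !(scale0r, scaler0).
  by rewrite scale1r wE // scalerA mulrC -scalerA (scalerA c^-1) mulVf ?scale1r.
apply: subspaceZ => //; apply: subspace_sum => // i _.
by apply: subspaceZ => //; apply: W_gl.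
Qed.

End MatrixUnits.

(** * Polarization by summed matrix units *)

Section Polarization.
Variables (R : realType) (n : nat).
Local Notation C := (R[i]).
Local Notation T := {mpoly C[n]}.
Implicit Types (p q : T) (m : 'X_{1..n}) (j : 'I_n) (g : 'S_n).

Let D k' k p : T := \sum_j munit j k' k p.

Variables (N : nat) (kp lp : nat -> nat) (u : T).
Hypotheses (kpN : forall i, (kp i < N)%N) (lpN : forall i, (lp i < N)%N).
Hypothesis uN : forall m, u@_m != 0 -> forall j, (m j < N)%N.

(** Exponents from [N] on are markers: stage [i] turns an exponent [kp i] into the marker [N + i],
    which no monomial of [u] contains. After [r] stages each of the first [r] markers sits in
    exactly one factor, which is the condition [raised]. *)
Fixpoint raise r := if r is r'.+1 then D (N + r') (kp r') (raise r') else u.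

Let raised r m := [forall j, m j < N + r]%N &&
  [forall i : 'I_n, (i < r)%N ==> (#|[pred j | m j == N + i]%N| == 1)%N].

Let unraise m : 'X_{1..n} := [multinom (if (m j < N)%N then m j else kp (m j - N)) | j < n].

(** Undoing the newest marker returns to the previous stage; as [kp r] is below [N], the restored
    exponent is no marker. *)
Let raisedS r m j : (r < n)%N -> m j = (N + r)%N ->
  raised r.+1 m = raised r (mset j (kp r) m).
Proof.
move=> rn mj.
have cnt (i : 'I_n) : (i < r)%N ->
    #|[pred l | mset j (kp r) m l == N + i]%N| = #|[pred l | m l == N + i]%N|.
  move=> ir; apply: eq_card => l; rewrite !inE mnmE; case: (eqVneq l j) => [->|//].
  rewrite mj eqn_add2l (gtn_eqF ir); apply: ltn_eqF.
  exact: leq_trans (kpN _) (leq_addr _ _).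
apply/andP/andP => -[/forallP mN /forallP c1]; split; apply/forallP => i.
- rewrite mnmE; case: eqVneq => [_|ij]; first exact: leq_trans (kpN _) (leq_addr _ _).
  have := mN i; rewrite addnS ltnS leq_eqVlt => /orP[/eqP mi|//].
  have := c1 (Ordinal rn); rewrite ltnSn /= => /eqP/eqP/card1P[l lP].
  have /eqP il : i \in pred1 l by rewrite -lP inE mi.
  have /eqP jl : j \in pred1 l by rewrite -lP inE mj.
  by rewrite il jl eqxx in ij.
- apply/implyP => ir; rewrite cnt //.
  by have := c1 i; rewrite ltnS (ltnW ir).
- case: (eqVneq i j) => [->|ij]; first by rewrite mj addnS.
  by have := mN i; rewrite mnmE (negPf ij) addnS ltnS => /ltnW.
- apply/implyP; rewrite ltnS leq_eqVlt => /orP[/eqP ir|ir]; last first.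
    by have := c1 i; rewrite ir cnt.
  apply/eqP/(@eq_card1 _ j) => l; rewrite !inE ir.
  case: (eqVneq l j) => [->|lj]; first by rewrite mj eqxx.
  by have := mN l; rewrite mnmE (negPf lj) => /ltn_eqF.
Qed.

Let unraise_mset r m j : m j = (N + r)%N -> unraise (mset j (kp r) m) = unraise m.
Proof.
move=> mj; apply/mnmP => i; rewrite !mnmE; case: eqP => // ->.
by rewrite kpN mj ltnNge leq_addr addKn.
Qed.

Let mcoeff_raise r m : (r <= n)%N ->
  (raise r)@_m = if raised r m then u@_(unraise m) else 0.
Proof.
elim: r m => [|r IH] m rn.
  case: ifP => [/andP[/forallP mN _]|mN].
    congr (_@__); apply/mnmP => j; rewrite mnmE.
    by have := mN j; rewrite addn0 => ->.
  apply/eqP; apply: contraFT mN => /uN um; apply/andP; split.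
    by apply/forallP => j; rewrite addn0.
  by apply/forallP => i.
rewrite /= /D raddf_sum /=.
under eq_bigr => j _ do rewrite mcoeff_munit.
(* Each [j] carrying the newest marker contributes the same value. It is 0 unless [m] is raised, and
   then there is exactly one such [j]. *)
rewrite -big_mkcond (eq_bigr (fun=> if raised r.+1 m then u@_(unraise m) else 0)); last first.
  by move=> j /eqP mj; rewrite (IH _ (ltnW rn)) -(raisedS rn mj) (unraise_mset mj).
case: ifP => rm; last by rewrite big1.
have /andP[_ /forallP/(_ (Ordinal rn))] := rm; rewrite ltnSn /= => /eqP c1.
by rewrite sumr_const c1.
Qed.

Let shift g : 'X_{1..n} := [multinom (N + g j)%N | j < n].

Let kappa : 'X_{1..n} := [multinom kp j | j < n].

Let raised_shift g : raised n (shift g).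
Proof.
apply/andP; split; apply/forallP => i; first by rewrite mnmE ltn_add2l.
apply/implyP => _; rewrite (@eq_card1 _ (g^-1%g i)) // => j; rewrite !inE mnmE.
by rewrite eqn_add2l val_eqE (can2_eq (permK g) (permKV g)).
Qed.

(** After [n] stages the [n] markers fill the [n] factors, and [g] is the inverse of the map from a
    marker to its position. *)
Let raised_ex m : raised n m -> exists g, m = shift g.
Proof.
case/andP => _ /forallP ex.
have ex1 (i : 'I_n) : exists j, m j == (N + i)%N.
  have := ex i; rewrite ltn_ord /= => /eqP c1; apply/existsP.
  have : (0 < #|[pred j | m j == N + i]%N|)%N by rewrite c1.
  by case/card_gt0P => j; rewrite inE => mj; apply/existsP; exists j.
pose f i := xchoose (ex1 i).
have fP i : m (f i) = (N + i)%N by apply/eqP/(xchooseP (ex1 i)).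
have f_inj : injective f.
  by move=> i i' ff; have := fP i; rewrite ff fP => /addnI /val_inj.
exists (perm f_inj)^-1%g; apply/mnmP => j.
by rewrite mnmE -{1}(permKV (perm f_inj) j) permE fP.
Qed.

Let unraise_shift g : unraise (shift g) = mcomp kappa g.
Proof. by apply/mnmP => j; rewrite !mnmE ltnNge leq_addr addKn. Qed.

Let shift_inj : injective shift.
Proof.
move=> g h /mnmP gh; apply/permP => j; apply/val_inj.
by have := gh j; rewrite !mnmE => /addnI.
Qed.

Lemma raiseE : raise n = \sum_g u@_(mcomp kappa g) *: 'X_[shift g].
Proof.
apply/mpolyP => m; rewrite mcoeff_raise // raddf_sum /=.
under eq_bigr => g _ do rewrite mcoeffZ mcoeffX.
case: ifP => [/raised_ex[g ->]|rm].
  rewrite (bigD1 g) //= eqxx mulr1 big1 ?addr0 => [|h hg].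
    by rewrite unraise_shift.
  by rewrite (inj_eq shift_inj) (negPf hg) mulr0.
rewrite big1 // => g _; case: eqP => [gm|_]; rewrite ?mulr0 //.
by rewrite -gm raised_shift in rm.
Qed.

Fixpoint lower r := if r is r'.+1 then D (lp r') (N + r') (lower r') else raise n.

Lemma lowerE r : (r <= n)%N -> lower r = \sum_g u@_(mcomp kappa g) *:
  'X_[[multinom (if (g j < r)%N then lp (g j) else (N + g j)%N) | j < n]].
Proof.
elim: r => [_|r IH rn]; first by rewrite /= raiseE.
rewrite [LHS]/= IH ?(ltnW rn) // /D.
under eq_bigr => j _ do rewrite linear_sum.
rewrite exchange_big; apply: eq_bigr => g _ /=.
under eq_bigr => j _ do rewrite linearZ /= munitX.
rewrite -scaler_sumr; congr (_ *: _).
(* In the term of [g] the marker [N + r] occurs only in factor [g^-1 r]; lowered exponents are below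
   [N] and cannot be mistaken for it. *)
rewrite (bigD1 (g^-1%g (Ordinal rn))) //= big1 ?addr0 => [|j jg].
  rewrite mnmE permKV /= ltnn eqxx; congr ('X_[_]).
  apply/mnmP => j; rewrite !mnmE -(can2_eq (permK g) (permKV g)) [in RHS]ltnS [in RHS]leq_eqVlt -val_eqE /=.
  by case: eqP => [->|].
rewrite mnmE; case: ltnP => _; first by rewrite ltn_eqF // (leq_trans (lpN _)) ?leq_addr.
rewrite eqn_add2l; case: eqP => // gj; case/eqP: jg.
by apply: (canRL (permK g)); apply/val_inj.
Qed.

End Polarization.

Section Density.
Variables (R : realType) (n : nat) (lam : R[i]).
Hypothesis hlam : forall k : nat, k != 0%N -> lam != k%:R.
Variable W : tens R n -> Prop.
Hypotheses (W_sub : is_subspace W) (W_gl : gl_invariant lam W).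

(** For a monomial of [p], the vector [u] is raised at the exponents of [m] and then lowered to
    those of the monomial; linearity gives all [p]. *)
Lemma gl_density u (m : 'X_{1..n}) (p : tens R n) : W u ->
  W (gact [ffun g => u@_(mcomp m g)] p).
Proof.
move=> Wu.
have monom (m' : 'X_{1..n}) : W (\sum_g u@_(mcomp m g) *: 'X_[mcomp m' g]).
  (* Raising and lowering take sequences on all naturals, hence the extension by 0; [N] exceeds
     every exponent involved. *)
  pose ext (k : 'X_{1..n}) (i : nat) := oapp k 0%N (insub i).
  pose N := (msize u + mdeg m + mdeg m').+1.
  have mle (k : 'X_{1..n}) (j : 'I_n) : (k j <= mdeg k)%N.
    by rewrite mdegE (bigD1 j) //= leq_addr.
  have extle k i : (ext k i <= mdeg k)%N by rewrite /ext; case: insubP => //= *; exact: mle.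
  have kN i : (ext m i < N)%N.
    by rewrite ltnS (leq_trans (extle _ _)) // addnAC leq_addl.
  have lN i : (ext m' i < N)%N by rewrite ltnS (leq_trans (extle _ _)) // leq_addl.
  have uN k : u@_k != 0 -> forall j, (k j < N)%N.
    rewrite -mcoeff_msupp => /msize_mdeg_lt ku j.
    by rewrite ltnS (leq_trans (mle _ _)) // (leq_trans (ltnW ku)) // -addnA leq_addr.
  have := lowerE kN lN uN (leqnn n).
  have extE k (i : 'I_n) : ext k i = k i by rewrite /ext valK.
  have -> : [multinom ext m j | j < n] = m by apply/mnmP => j; rewrite mnmE extE.
  move=> lE; have -> : \sum_g u@_(mcomp m g) *: 'X_[mcomp m' g] =
    lower N (ext m) (ext m') u n.
    rewrite lE; apply: eq_bigr => g _; congr (_ *: 'X_[_]); apply/mnmP => j.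
    by rewrite !mnmE ltn_ord extE.
  have Wr r : W (raise N (ext m) u r) by elim: r => //= r IH; exact: (gl_munit hlam W_sub W_gl).
  have Wl r : W (lower N (ext m) (ext m') u r) by elim: r => //= r IH; exact: (gl_munit hlam W_sub W_gl).
  exact: Wl.
rewrite (mpolyE p) linear_sum; apply: subspace_sum => // k _.
rewrite linearZ; apply: subspaceZ => //.
rewrite /gact; have := monom k; congr W; apply: eq_bigr => g _.
by rewrite ffunE perm_actX invgK.
Qed.

End Density.

(** * Specht modules *)

Section Specht.
Variables (R : realType) (n : nat) (nu : partitions n).
Local Notation C := (R[i]).
Local Notation A := (galg C 'S_n).
Implicit Types (f : Mperm n R) (s t g : 'S_n).

Lemma MpermZE (a : C) f x : (a *: f) x = a * f x.
Proof. by rewrite ffunE. Qed.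

Lemma Mperm_sumE (I : Type) (r : seq I) (P : pred I) (F : I -> Mperm n R) x :
  (\sum_(i <- r | P i) F i) x = \sum_(i <- r | P i) F i x.
Proof. by elim/big_rec2: _ => [|i y1 y2 _ <-]; rewrite ffunE. Qed.

(* The embedding M^nu -> C[S_n] sending the tabloid of the identity tableau to
   [rsym nu]; it maps S^nu onto C[S_n] b a. *)
Definition hat f : A := [ffun g => f (tabloid_of nu g)].

Lemma hat_sum (I : finType) (c : I -> C) (F : I -> Mperm n R) :
  hat (\sum_i c i *: F i) = \sum_i c i *: hat (F i).
Proof.
apply/galgP => g; rewrite ffunE Mperm_sumE galg_sumE; apply: eq_bigr => i _.
by rewrite MpermZE galgZE ffunE.
Qed.

Lemma hat_perm_tab s f : hat (perm_tab s f) = gel s^-1 * hat f.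
Proof.
apply/galgP => g; rewrite gel_mulE !ffunE invgK; congr (f _).
by apply/ffunP => x; rewrite !ffunE permM.
Qed.

Lemma tabloid_of_eq s t :
  (tabloid_of nu s == tabloid_of nu t) = ((t^-1 * s)%g \in row_group nu).
Proof.
have lt (x : 'I_n) : (row_of nu x < n.+1)%N.
  by have [/ltnW] := row_of_bounds nu (ltn_ord x).
apply/eqP/row_groupP => [/ffunP E x|E].
  have /(congr1 val) := E (t^-1%g x).
  by rewrite !ffunE /= !inordK // permM permKV.
apply/ffunP => x; rewrite !ffunE; congr inord.
by have := E (t x); rewrite permM permK.
Qed.

Lemma hat_polytab t : hat (polytab R nu t) = gel t * (csym C nu * rsym C nu).
Proof.
apply/galgP => g; rewrite gel_mulE galgME ffunE Mperm_sumE.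
rewrite [LHS]big_mkcond /=.
(* The substitution [s = t * h^-1 * t^-1] turns permutations of the entries of [t] into permutations
   of the cells. *)
have bij : injective (fun h => t * h^-1 * t^-1)%g.
  by move=> a b /mulIg/mulgI/invg_inj.
rewrite [LHS](reindex_inj bij); apply: eq_bigr => h _ /=.
rewrite csymE rsymE.
have -> : col_stab nu t (t * h^-1 * t^-1)%g = (h \in col_group nu).
  rewrite -groupV; apply/forallP/col_groupP => [E x|E x].
    by have /eqP := E (t^-1%g x); rewrite !permM !permKV.
  by rewrite !permM permKV E.
case: ifP => _; last by rewrite mul0r.
rewrite MpermZE ffunE !odd_permM !odd_permV addbAC addbb addFb; congr (_ * _%:R).
by rewrite tabloid_of_eq !invMg !invgK !mulgA mulVg mul1g.
Qed.

Lemma hat_specht f : in_specht nu f -> exists x, hat f = x * (csym C nu * rsym C nu).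
Proof.
case=> c ->; exists (\sum_t c t *: gel t); rewrite hat_sum mulr_suml.
by apply: eq_bigr => t _; rewrite hat_polytab scalerAl.
Qed.

Lemma in_specht_sum (I : finType) (c : I -> C) (F : I -> Mperm n R) :
  (forall i, in_specht nu (F i)) -> in_specht nu (\sum_i c i *: F i).
Proof.
move=> /fin_all_exists[a aE]; exists (fun t => \sum_i c i * a i t).
under eq_bigr => i _ do rewrite aE scaler_sumr.
rewrite exchange_big; apply: eq_bigr => t _ /=; rewrite scaler_suml.
by apply: eq_bigr => i _; rewrite scalerA.
Qed.

(** The type [tabloid] also contains maps that are no tabloids of shape [nu]. They are invisible to
    [hat], but Specht vectors vanish there. *)
Lemma hat_eq0 f : in_specht nu f -> hat f = 0 -> f = 0.
Proof.
case=> c fE /galgP h0; apply/ffunP => tau; rewrite [RHS]ffunE.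
case: (pickP [pred g | tabloid_of nu g == tau]) => [g /eqP <-|none].
  by have := h0 g; rewrite ffunE galg0E.
rewrite fE Mperm_sumE big1 // => t _; rewrite MpermZE Mperm_sumE big1 ?mulr0 // => s _.
by rewrite MpermZE ffunE eq_sym [_ == tau]none mulr0.
Qed.

(** By [hat_specht] and [csym_rsym_young], a further multiplication by [rsym] recovers [hat f] up to
    a nonzero scalar. *)
Lemma hat_young_eq0 f : in_specht nu f -> hat f * young C nu = 0 -> f = 0.
Proof.
move=> fS hy; apply: hat_eq0 => //; have [x xE] := hat_specht fS.
have [k k0 [ky yr]] := csym_rsym_young C nu.
move: hy; rewrite xE -mulrA ky -scalerAr => /eqP.
rewrite scaler_eq0 (negPf k0) /= => /eqP hy.
have /eqP : x * young C nu * rsym C nu = 0 by rewrite hy mul0r.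
by rewrite -mulrA yr -scalerAr scaler_eq0 (negPf k0) /= => /eqP.
Qed.

(** The rows are the polytabloids; the rank factorization of this matrix provides the dimension, a
    basis and the coordinates of polytabloids. *)
Definition specht_mx : 'M[C]_(#|'S_n|, #|tabloid n|) :=
  \matrix_(i, j) polytab R nu (enum_val i) (enum_val j).

Definition specht_dim := \rank specht_mx.

Definition specht_vec (i : 'I_specht_dim) : Mperm n R :=
  [ffun tau => row_base specht_mx i (enum_rank tau)].

Definition specht_coord t i : C := col_base specht_mx (enum_rank t) i.

Lemma polytab_coord t : polytab R nu t = \sum_i specht_coord t i *: specht_vec i.
Proof.
apply/ffunP => tau; rewrite [RHS]Mperm_sumE.
have := congr1 (fun M : 'M_(_, _) => M (enum_rank t) (enum_rank tau)) (mulmx_base specht_mx).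
rewrite !mxE !enum_rankK => <-; apply: eq_bigr => i _.
by rewrite MpermZE ffunE.
Qed.

Lemma specht_vec_basis : specht_basis nu specht_vec.
Proof.
split=> [i|f [c ->]|c c0 i].
- have /submxP[D DE] : (row i (row_base specht_mx) <= specht_mx)%MS.
    by rewrite (submx_trans (row_sub _ _)) // eq_row_base.
  exists (fun t => D 0 (enum_rank t)); apply/ffunP => tau; rewrite ffunE Mperm_sumE.
  have /rowP/(_ (enum_rank tau)) := DE; rewrite !mxE => ->.
  rewrite (reindex _ (onW_bij _ (@enum_rank_bij 'S_n))) /=.
  by apply: eq_bigr => t _; rewrite mxE !enum_rankK MpermZE.
- exists (fun i => \sum_t c t * specht_coord t i).
  under eq_bigr => t _ do rewrite polytab_coord scaler_sumr.
  rewrite exchange_big; apply: eq_bigr => i _ /=; rewrite scaler_suml.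
  by apply: eq_bigr => t _; rewrite scalerA.
- have : \row_i c i *m row_base specht_mx = 0.
    apply/rowP => j; rewrite !mxE.
    have /ffunP/(_ (enum_val j)) := c0; rewrite Mperm_sumE [RHS]ffunE => E.
    rewrite -[RHS]E.
    by apply: eq_bigr => k _; rewrite MpermZE ffunE enum_valK mxE.
  rewrite -[RHS](mul0mx _ (row_base specht_mx)) => E.
  by have /rowP/(_ i) := row_free_inj (row_base_free _) E; rewrite !mxE.
Qed.

End Specht.

(** * Decomposition *)

Section Irreducible.
Variables (R : realType) (n : nat) (lam : R[i]).
Local Notation C := (R[i]).
Hypothesis hlam : forall k : nat, k != 0%N -> lam != k%:R.
Variable e : galg C 'S_n.
Hypotheses (e_star : gstar e = e) (e_neq0 : e != 0).
Hypothesis e_prim : forall x, exists c, e * x * e = c *: e.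

Definition gimage (p : tens R n) : Prop := exists q, p = gact e q.

Let cE := cornerE e_star e_neq0 e_prim.

Lemma gimageE p : gimage p -> gact e p = corner e 1 *: p.
Proof. by case=> q ->; rewrite -gactM -gactZ -cE mulr1. Qed.

Lemma gimage_corner x p : gimage p -> gact (e * x) p = corner e x *: p.
Proof. by case=> q ->; rewrite -gactM -gactZ -cE. Qed.

Lemma gimage_subspace : is_subspace gimage.
Proof.
split=> [|a p q [p' ->] [q' ->]]; first by exists 0; rewrite linear0.
by exists (a *: p' + q'); rewrite linearP.
Qed.

Lemma gimage_irreducible : gl_irreducible lam gimage.
Proof.
split; first exact: gimage_subspace.
- by move=> w p [q ->]; exists (gl_act lam w q); rewrite gact_gl_act.
(* The exponents of [m] are distinct, so no nontrivial permutation fixes it, and the coefficient of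
   [gact e 'X_[m]] at [m] is the nonzero [e 1%g]. *)
- pose m : 'X_{1..n} := [multinom j : nat | j < n].
  exists (gact e 'X_[m]); first by exists 'X_[m].
  apply/eqP => /(congr1 (mcoeff m)); rewrite mcoeff0 /gact raddf_sum /= (bigD1 1%g) //=.
  rewrite big1 => [|g g1].
    rewrite mcoeffZ invg1 perm_act1 mcoeffX eqxx mulr1 addr0.
    exact/eqP/(corner_unit_neq0 e_star e_neq0 e_prim).
  rewrite mcoeffZ perm_actX invgK mcoeffX; case: eqP => [/mnmP mg|]; rewrite ?mulr0 //.
  case/eqP: g1; apply/permP => j; rewrite perm1; apply/val_inj.
  by have := mg j; rewrite !mnmE.
move=> W W_sub W_gl WU [u Wu u0] p [y ->].
have Uu := WU _ Wu.
(* This combination is chosen so that its coefficients are values of [corner e], as [vK] shows. It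
   is nonzero since [e] takes it to a nonzero multiple of [u]. *)
pose v := gact (\sum_g corner e (gel g) *: gel g^-1) u.
have ev : gact e v = (\sum_g corner e (gel g) * corner e (gel g^-1)) *: u.
  rewrite /v -gactM mulr_sumr gact_sum scaler_suml; apply: eq_bigr => g _.
  by rewrite -scalerAr gactZ gimage_corner // scalerA.
have v0 : v != 0.
  apply/eqP => v0; move/eqP: ev; rewrite v0 linear0 eq_sym scaler_eq0 (negPf u0) orbF.
  by rewrite (negPf (corner_gel_neq0 e_star e_neq0 e_prim)).
have [m vm] : exists m, v@_m != 0.
  by exists (mlead v); rewrite mleadc_eq0.
pose K : galg C 'S_n := [ffun g => u@_(mcomp m g)].
have vK : v@_m = corner e K.
  rewrite (galgE K) [RHS]linear_sum /v gact_sum raddf_sum; apply: eq_bigr => g _ /=.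
  by rewrite gactZ mcoeffZ gact_gel invgK mcoeff_perm_act linearZ /= ffunE mulrC.
have WK := gl_density hlam W_sub W_gl m (gact e y) Wu.
(* Applying [e] to [K e y], which lies in [W] and so in the image of [e], yields both [corner e 1]
   times itself and [corner e K] times [e y]. Hence [e y] is a multiple of it. *)
have := gimageE (WU _ WK); rewrite -/K -!gactM ?mulrA cE gactZ => KE.
have -> : gact e y = (corner e K)^-1 * corner e 1 *: gact (K * e) y.
  have cK0 : corner e K != 0 by rewrite -vK.
  by rewrite -scalerA -KE (scalerA (_^-1)) (mulVf cK0) scale1r.
rewrite gactM; exact: (subspaceZ W_sub _ WK).
Qed.

End Irreducible.

(** * The maps from the Specht tensor factors *)

Section Decomposition.
Variables (R : realType) (n : nat).
Local Notation C := (R[i]).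
Local Notation e := (young C).
Implicit Types nu mu : partitions n.

Definition isotypic nu (i : 'I_(specht_dim R nu)) (p : tens R n) : tens R n :=
  gact (hat nu (specht_vec i)) p.

Lemma isotypic_perm_act nu (i : 'I_(specht_dim R nu)) (s : 'S_n) (c : 'I_(specht_dim R nu) -> C) :
  perm_tab s (specht_vec i) = \sum_k c k *: specht_vec k ->
  forall p, perm_act s (isotypic i p) = \sum_k c k *: isotypic k p.
Proof.
move=> sE p; rewrite -[s in LHS]invgK -gact_gel -gactM -hat_perm_tab sE hat_sum gact_sum.
by apply: eq_bigr => k _; rewrite gactZ.
Qed.

(** In the expansion of 1 by [young_complete], each [gel g * e nu] equals, up to [k nu], the image
    under [hat] of the polytabloid of [g] times [e nu]. Expanding that polytabloid in the Specht
    basis gives the witness [u]. *)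
Lemma isotypic_span (x : tens R n) :
  exists u : forall nu, 'I_(specht_dim R nu) -> tens R n,
    (forall nu i, gimage (e nu) (u nu i)) /\ x = \sum_nu \sum_i isotypic i (u nu i).
Proof.
have [c cE] := young_complete C n.
have kex nu : exists k, k != 0 /\
    forall y, y * (csym C nu * rsym C nu) * e nu = k *: (y * e nu).
  by have [k k0 kP] := mul_csym_rsym_young C nu; exists k.
have [k kP] := fin_all_exists kex.
exists (fun nu i => \sum_g (c nu / k nu * specht_coord g i) *: gact (e nu) (gact (gel g^-1) x)).
split=> [nu i|].
  apply: (subspace_sum (gimage_subspace _)) => g _.
  by apply: (subspaceZ (gimage_subspace _)); eexists.
rewrite -{1}(gact1 x) cE gact_sum; apply: eq_bigr => nu _.
have [k0 ky] := kP nu.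
rewrite gactZ gact_sum scaler_sumr.
under [RHS]eq_bigr => i _ do rewrite /isotypic linear_sum.
rewrite exchange_big; apply: eq_bigr => g _ /=.
transitivity ((c nu / k nu) *: gact (hat nu (polytab R nu g))
                (gact (e nu) (gact (gel g^-1) x))).
  rewrite hat_polytab -(gactM _ (e nu)) (ky (gel g)) gactZ scalerA (divfK k0).
  by rewrite (gactM (gel g * e nu)).
rewrite polytab_coord hat_sum gact_sum scaler_sumr; apply: eq_bigr => i _.
by rewrite gactZ [RHS]linearZ /= scalerA.
Qed.

(** Applying [e mu * gel g] to the relation kills the other shapes and leaves scalar relations among
    the [u mu j]. For each monomial, the Specht vector with its coefficients in the [u mu j] is then
    0 by [corner_separating] and [hat_young_eq0]. *)
Lemma isotypic_free (u : forall nu, 'I_(specht_dim R nu) -> tens R n) :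
  (forall nu i, gimage (e nu) (u nu i)) ->
  \sum_nu \sum_i isotypic i (u nu i) = 0 -> forall nu i, u nu i = 0.
Proof.
move=> uU u0 mu i.
have key g : \sum_(j < specht_dim R mu)
    corner (e mu) (gel g * hat mu (specht_vec j)) *: u mu j = 0.
  have := congr1 (gact (e mu * gel g)) u0; rewrite linear0 linear_sum => E.
  rewrite -[RHS]E (bigD1 mu) //= [X in _ = _ + X]big1 ?addr0 => [|nu ne].
    rewrite linear_sum; apply: eq_bigr => j _.
    rewrite -[RHS]gactM -mulrA gimage_corner //.
    + exact: young_star.
    + exact: young_neq0.
    + exact: young_prim.
  rewrite linear_sum big1 // => j _; have [q ->] := uU nu j.
  rewrite /= /isotypic -(gactM (e mu * gel g)) -(gactM _ (e nu)) -(mulrA (e mu)).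
  by rewrite young_orth ?gact0 // eq_sym.
apply/mpolyP => m; rewrite mcoeff0.
have [bS _ bfree] := @specht_vec_basis R n mu.
apply: (bfree (fun j => (u mu j)@_m)).
apply: (@hat_young_eq0 _ _ mu); first exact: in_specht_sum.
apply: (@corner_separating _ _ (e mu)) => [|||g].
- exact: young_star.
- exact: young_neq0.
- exact: young_prim.
rewrite hat_sum mulr_sumr linear_sum.
have := congr1 (mcoeff m) (key g); rewrite mcoeff0 raddf_sum => E.
rewrite -[RHS]E; apply: eq_bigr => j _ /=.
by rewrite -scalerAr linearZ mcoeffZ mulrC.
Qed.

End Decomposition.

Theorem theorem7p2 (R : realType) (lam : R[i])
  (hlam : forall k : int, k != 0 -> lam != k%:~R)
  (n : nat) (hn : (1 <= n)%N) :
  exists (U : partitions n -> tens R n -> Prop) (d : partitions n -> nat)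
         (b : forall nu, 'I_(d nu) -> Mperm n R)
         (psi : forall nu, 'I_(d nu) -> tens R n -> tens R n),
    gl_Sn_decomposition lam U b psi.
Proof.
exists (fun nu => gimage (young (R[i]) nu)), (@specht_dim R n), (@specht_vec R n),
  (@isotypic R n).
split; [|split; [|split; [|split; [|split; [|split]]]]].
- move=> nu; apply: gimage_irreducible.
  + by move=> k k0; exact: (hlam k).
  + exact: young_star.
  + exact: young_neq0.
  + exact: young_prim.
- exact: specht_vec_basis.
- by move=> nu i a p q _ _; exact: gact_is_linear.
- by move=> nu i w p _; exact: gact_gl_act.
- by move=> nu i s c sE p _; exact: isotypic_perm_act.
- exact: isotypic_span.
- exact: isotypic_free.
Qed.
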